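(* Let $n\ge 2$, let $G$ be a proper open subset of $\mathbb{R}^n$, let $1<p<\infty$, and let $\lambda>1$ be the fixed dilation parameter in the definition of $\mathcal{K}^p_{f,\mathrm{loc}}(G)$. There exists a positive constant $C$, depending only on $n$, $p$ and $\lambda$, such that for every $f\in L^1(G)$ $$\mathcal{K}_f^p(G)\le C\,\mathcal{K}^p_{f,\mathrm{loc}}(G).$$
   Context: A cube in $\mathbb{R}^n$ is a closed cube with sides parallel to the coordinate axes; $\ell(Q)$ is its side length, and for $\lambda>0$, $\lambda Q$ is the cube with the same center as $Q$ and side length $\lambda\ell(Q)$. $|A|$ is the Lebesgue measure of $A\subset\mathbb{R}^n$, $\chi_A$ its characteristic function, and $f_Q=\frac{1}{|Q|}\int_Q f\,dx$. Admissible partitions: an admissible partition $\mathcal{P}(G)$ of $G$ is a family of cubes with $Q\subset G$ for each $Q\in\mathcal{P}(G)$, with pairwise disjoint interiors, and with $G=\bigcup_{Q\in\mathcal{P}(G)}Q$. Define $$\mathcal{K}_f^p(G)=\sup_{\mathcal{P}(G)}\sum_{Q\in\mathcal{P}(G)}|Q|\left(\frac1{|Q|}\int_Q|f(x)-f_Q|\,dx\right)^p,$$ the supremum being over all admissible partitions of $G$. Local partitions: fix $\lambda>1$ and a finite constant $N\ge1$ depending only on $n$ (fixed once and for all and sufficiently large; in particular at least the dimensional overlap bound of the families $\{\frac98Q\}$, $Q$ ranging over a Whitney decomposition of an open set). A local partition $\mathcal{P}_{\mathrm{loc}}(G)$ is a family of cubes with $G=\bigcup_{Q\in\mathcal{P}_{\mathrm{loc}}(G)}Q$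 such that $\lambda Q\subset G$ for each $Q\in\mathcal{P}_{\mathrm{loc}}(G)$ and $\sup_{x\in G}\sum_{Q\in\mathcal{P}_{\mathrm{loc}}(G)}\chi_Q(x)\le N$ (interiors need not be disjoint). Define $$\mathcal{K}_{f,\mathrm{loc}}^p(G)=\sup_{\mathcal{P}_{\mathrm{loc}}(G)}\sum_{Q\in\mathcal{P}_{\mathrm{loc}}(G)}|Q|\left(\frac1{|Q|}\int_Q|f(x)-f_Q|\,dx\right)^p,$$ the supremum being over all local partitions of $G$. Both quantities may be $+\infty$. *)

(* Defs.v *)
From HB Require Import structures.
From mathcomp Require Import all_boot all_order all_algebra.
From mathcomp Require Import all_classical all_reals all_analysis.
Set Implicit Arguments.
Unset Strict Implicit.
Unset Printing Implicit Defensive.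
Import Order.TTheory GRing.Theory Num.Theory.
Import numFieldNormedType.Exports.
Local Open Scope classical_set_scope.
Local Open Scope ring_scope.

(* The sigma-algebra on row vectors generated by the coordinates, by analogy
   with the library's instance on n.-tuple T. *)
Section measurable_rV.
Context {R : realType}.
Variable n : nat.

Let coord (i : 'I_n) (x : 'rV[R]_n) : R := x ord0 i.

Let rV_set0 : g_sigma_preimage coord set0.
Proof. exact: sigma_algebra0. Qed.

Let rV_setC A : g_sigma_preimage coord A -> g_sigma_preimage coord (~` A).
Proof. exact: sigma_algebraC. Qed.

Let rV_bigcup (F : (set 'rV[R]_n)^nat) :
  (forall i, g_sigma_preimage coord (F i)) ->
  g_sigma_preimage coord (\bigcup_i (F i)).
Proof. exact: sigma_algebra_bigcup. Qed.

HB.instance Definition _ := @isMeasurable.Build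
  (measure_tuple_display default_measure_display) 'rV[R]_n
  (g_sigma_preimage coord) rV_set0 rV_setC rV_bigcup.

End measurable_rV.

Definition rV_cons {R : realType} n (p : measurableTypeR R * 'rV[R]_n) :
    'rV[R]_n.+1 :=
  row_mx (const_mx p.1 : 'rV[R]_1) p.2.

(* Product measure on the sigma-algebra generated by the coordinates. *)
Fixpoint product_lebesgue (R : realType) n : set 'rV[R]_n -> \bar R :=
  if n is n'.+1 then
    fun A => (lebesgue_measure \x @product_lebesgue R n')%E (@rV_cons R n' @^-1` A)
  else \d_(0 : 'rV[R]_0).
Arguments product_lebesgue : clear implicits.

Section product_lebesgue_measure.
Context {R : realType}.

Lemma rV_cons0 n (p : measurableTypeR R * 'rV[R]_n) : rV_cons p ord0 ord0 = p.1.
Proof.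
rewrite /rV_cons mxE; case: splitP => [j _|j /= /eqP]; last by rewrite eq_sym.
by rewrite mxE.
Qed.

Lemma rV_consS n (p : measurableTypeR R * 'rV[R]_n) (i : 'I_n) :
  rV_cons p ord0 (lift ord0 i) = p.2 ord0 i.
Proof.
rewrite /rV_cons mxE; case: splitP => [j /= |j /= /eqP].
  by rewrite ord1.
by rewrite /bump /= !add1n eqSS => /eqP ij; congr (p.2 _ _); exact: val_inj.
Qed.

Lemma measurable_coord n (i : 'I_n) :
  measurable_fun [set: 'rV[R]_n] (fun x : 'rV[R]_n => x ord0 i : R).
Proof.
move=> _ Y mY; rewrite setTI; apply: sub_sigma_algebra => /=.
rewrite -bigcup_seq/=; exists i => /=; first by rewrite mem_index_enum.
by exists Y => //; rewrite setTI.
Qed.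

Lemma measurable_fun_rVP d (T : measurableType d) n (f : T -> 'rV[R]_n) :
  (forall i, measurable_fun [set: T] (fun x => f x ord0 i : R)) ->
  measurable_fun [set: T] f.
Proof.
move=> mf _ A; rewrite setTI.
pose S : set (set 'rV[R]_n) := [set B | measurable (f @^-1` B)].
suff : <<s \big[setU/set0]_(i < n) preimage_set_system setT
    (fun x : 'rV[R]_n => x ord0 i : R) measurable >> `<=` S by exact.
apply: smallest_sub.
  split => /=; first by rewrite /S /= preimage_set0; exact: measurable0.
  - by move=> B; rewrite /S /= setTD preimage_setC; exact: measurableC.
  - by move=> F mF; rewrite /S /= preimage_bigcup; by apply: bigcupT_measurable.
rewrite -bigcup_seq; apply: bigcup_sub => i _ _ [B mB <-].
by rewrite /S /= setTI -[X in measurable X]setTI; exact: mf.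
Qed.

Lemma measurable_rV_cons n : measurable_fun [set: measurableTypeR R * 'rV[R]_n] (@rV_cons R n).
Proof.
apply: measurable_fun_rVP => i.
have [->|] := eqVneq i ord0.
  by under eq_fun do rewrite rV_cons0; exact: measurable_fst.
rewrite eq_sym => /unlift_some[j -> _].
under eq_fun do rewrite rV_consS.
by apply: (measurableT_comp (measurable_coord j)); exact: measurable_snd.
Qed.

End product_lebesgue_measure.

Section cons_measure.
Context {R : realType}.
Variable n : nat.
Variable m : {sigma_finite_measure set 'rV[R]_n -> \bar R}.

Definition cons_measure : set 'rV[R]_n.+1 -> \bar R :=
  pushforward (lebesgue_measure \x m)%E (@rV_cons R n).

HB.instance Definition _ := Measure.copy cons_measure
  (measure_function_pushforward__canonical__measure_function_Measure
    (lebesgue_measure \x m)%E (@measurable_rV_cons R n)).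

Let cons_sigma_finite : sigma_finite setT cons_measure.
Proof.
have [F FT Foo] : sigma_finite setT (lebesgue_measure \x m)%E.
  have /sigma_finiteP[F [TF ndF Foo]] := sigma_finiteT (@lebesgue_measure R).
  have /sigma_finiteP[G [TG ndG Goo]] := sigma_finiteT m.
  exists (fun k => F k `*` G k).
    rewrite -setXTT TF TG predeqE => -[x y]; split.
      move=> [/= [i _ Fix] [j _ Gjy]]; exists (maxn i j) => //; split.
      - by move: x Fix; exact/subsetPset/ndF/leq_maxl.
      - by move: y Gjy; exact/subsetPset/ndG/leq_maxr.
    by move=> [i _ []/= ? ?]; split; exists i.
  move=> k; have [? ?] := Foo k; have [? ?] := Goo k.
  split; first exact: measurableX.
  by rewrite product_measure1E// lte_mul_pinfty// ge0_fin_numE.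
pose unc (x : 'rV[R]_n.+1) : measurableTypeR R * 'rV[R]_n :=
  (x ord0 ord0, \row_i x ord0 (lift ord0 i)).
have consK : cancel (@rV_cons R n) unc.
  move=> [a x]; rewrite /unc rV_cons0; congr (_, _).
  by apply/rowP => i; rewrite mxE rV_consS.
have munc : measurable_fun [set: 'rV[R]_n.+1] unc.
  apply: measurable_fun_pair => /=; first exact: measurable_coord.
  apply: measurable_fun_rVP => i; under eq_fun do rewrite mxE.
  exact: measurable_coord.
exists (fun k => unc @^-1` F k).
  by rewrite -preimage_bigcup -FT preimage_setT.
move=> k; have [mF muF] := Foo k; split.
  by rewrite -[X in measurable X]setTI; exact: munc.
rewrite /cons_measure /pushforward.
rewrite (_ : _ @^-1` _ = F k)//; apply/seteqP; split => p /=; by rewrite consK.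
Qed.

HB.instance Definition _ := Measure_isSigmaFinite.Build _ _ _
  cons_measure cons_sigma_finite.

End cons_measure.

Section product_lebesgue_measure.
Context {R : realType}.
Variable n : nat.

Lemma product_lebesgueP :
  {mu : {sigma_finite_measure set 'rV[R]_n -> \bar R} |
    (mu : set 'rV[R]_n -> \bar R) = product_lebesgue R n}.
Proof.
apply: cid; elim: n => [|k [mu muE]]; first by exists (dirac (0 : 'rV[R]_0)).
by exists (cons_measure mu); apply/funext => A /=; rewrite /cons_measure -muE.
Qed.

Let mu := sval product_lebesgueP.
Let muE : (mu : set _ -> _) = product_lebesgue R n := svalP product_lebesgueP.

Let product_lebesgue0 : product_lebesgue R n set0 = 0%E.
Proof. by rewrite -muE measure0. Qed.

Let product_lebesgue_ge0 A : (0 <= product_lebesgue R n A)%E.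
Proof. by rewrite -muE measure_ge0. Qed.

Let product_lebesgue_sigma_additive : semi_sigma_additive (product_lebesgue R n).
Proof. by rewrite -muE; apply: measure_semi_sigma_additive. Qed.

HB.instance Definition _ := isMeasure.Build _ _ _ (product_lebesgue R n)
  product_lebesgue0 product_lebesgue_ge0 product_lebesgue_sigma_additive.

Let product_lebesgue_sigma_finite : sigma_finite setT (product_lebesgue R n).
Proof. by rewrite -muE; exact: sigma_finiteT. Qed.

HB.instance Definition _ := Measure_isSigmaFinite.Build _ _ _
  (product_lebesgue R n) product_lebesgue_sigma_finite.

End product_lebesgue_measure.

(* Lebesgue measure, as the completion of the product measure: the domain
   carries the sigma-algebra of Lebesgue (Caratheodory) measurable sets. *)
Definition lebesgue_rV (R : realType) n :=
  @completed_measure_extension _ _ _ (product_lebesgue R n).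

Arguments lebesgue_rV : clear implicits.

HB.instance Definition _ (R : realType) n := Measure.on (lebesgue_rV R n).

HB.instance Definition _ (R : realType) n :=
  Measure_isSigmaFinite.Build _ _ _ (lebesgue_rV R n)
    (completed_measure_extension_sigma_finite
      (sigma_finiteT (product_lebesgue R n))).

Section box.
Context {R : realType}.

Definition box n (a b : 'rV[R]_n) : set 'rV[R]_n :=
  [set x | forall i, a ord0 i <= x ord0 i <= b ord0 i].

Lemma measurable_box n (a b : 'rV[R]_n) : measurable (box a b).
Proof.
rewrite (_ : box a b = \bigcap_(i in [set: 'I_n])
    ((fun x : 'rV[R]_n => x ord0 i : R) @^-1` `[a ord0 i, b ord0 i])).
  apply: fin_bigcap_measurable => [|i _]; first exact: finite_finset.
  by rewrite -[X in measurable X]setTI; exact: measurable_coord.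
apply/seteqP; split => x /= abx => [i _|i]; first by rewrite /= in_itv/=.
by have := abx i Logic.I; rewrite /= in_itv.
Qed.

Lemma product_lebesgue_box n (a b : 'rV[R]_n) :
  (forall i, a ord0 i <= b ord0 i) ->
  product_lebesgue R n (box a b) = (\prod_i (b ord0 i - a ord0 i))%:E.
Proof.
elim: n a b => [|n IH] a b ab.
  by rewrite big_ord0 /= diracE mem_set// => -[].
pose t (x : 'rV[R]_n.+1) := \row_i x ord0 (lift ord0 i).
rewrite /= (_ : _ @^-1` _ = `[a ord0 ord0, b ord0 ord0] `*` box (t a) (t b)).
  rewrite product_measure1E//=; last exact: measurable_box.
  rewrite lebesgue_measure_itv /= lte_fin.
  rewrite IH; last by move=> i; rewrite !mxE.
  rewrite big_ord_recl EFinM; congr (_ * _)%E.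
    case: ifPn => //; rewrite -leNgt => ba.
    by rewrite (@le_anti _ _ (a ord0 ord0) (b ord0 ord0)) ?subrr// ab ba.
  by congr EFin; apply: eq_bigr => i _; rewrite !mxE.
apply/seteqP; split => -[r x] /=.
  move=> abx; split; first by have := abx ord0; rewrite rV_cons0 in_itv.
  by move=> i /=; have := abx (lift ord0 i); rewrite rV_consS !mxE.
rewrite in_itv/= => -[abr abx] i.
have [->|] := eqVneq i ord0; first by rewrite rV_cons0.
rewrite eq_sym => /unlift_some[j -> _].
by rewrite rV_consS; have := abx j; rewrite !mxE.
Qed.

Lemma lebesgue_rV_box n (a b : 'rV[R]_n) :
  (forall i, a ord0 i <= b ord0 i) ->
  lebesgue_rV R n (box a b) = (\prod_i (b ord0 i - a ord0 i))%:E.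
Proof.
move=> ab; rewrite /lebesgue_rV /completed_measure_extension.
rewrite measurable_mu_extE; first exact: product_lebesgue_box.
exact: measurable_box.
Qed.

End box.

Section john_nirenberg.
Context {R : realType} {n : nat}.
Implicit Types (Q : 'rV[R]_n * R) (G : set 'rV[R]_n) (f : 'rV[R]_n -> R).

(* A cube is encoded by its center Q.1 and its side length Q.2; the partitions
   below only contain pairs with 0 < Q.2. *)
Definition cube_set Q : set 'rV[R]_n :=
  [set x | forall i, `|x ord0 i - Q.1 ord0 i| <= Q.2 / 2].

Definition dilate (lambda : R) Q : 'rV[R]_n * R := (Q.1, lambda * Q.2).

Definition vol Q : R := fine (lebesgue_rV R n (cube_set Q)).

Definition avg Q f : R :=
  (vol Q)^-1 * \int[lebesgue_rV R n]_(x in cube_set Q) f x.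

Definition L1 G f : Prop := (lebesgue_rV R n).-integrable G (EFin \o f).

Definition oscillation_sum (p : R) f (P : set ('rV[R]_n * R)) : \bar R :=
  \esum_(Q in P) (vol Q * avg Q (fun x => `|f x - avg Q f|) `^ p)%:E.

Definition admissible_partition G : set (set ('rV[R]_n * R)) :=
  [set P | [/\ forall Q, P Q -> 0 < Q.2 /\ cube_set Q `<=` G,
      forall Q Q', P Q -> P Q' -> Q <> Q' ->
        interior (cube_set Q) `&` interior (cube_set Q') = set0 &
      G = \bigcup_(Q in P) cube_set Q]].

Definition local_partition (lambda : R) (N : nat) G :
    set (set ('rV[R]_n * R)) :=
  [set P | [/\ forall Q, P Q -> 0 < Q.2 /\ cube_set (dilate lambda Q) `<=` G,
      G = \bigcup_(Q in P) cube_set Q &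
      forall x, G x ->
        (\esum_(Q in P) (\1_(cube_set Q) x : R)%:E <= (N%:R : R)%:E)%E]].

Definition JN (p : R) f G : \bar R :=
  ereal_sup (oscillation_sum p f @` admissible_partition G).

Definition JN_loc (lambda : R) (N : nat) (p : R) f G : \bar R :=
  ereal_sup (oscillation_sum p f @` local_partition lambda N G).

Lemma cube_set_box Q :
  cube_set Q = box (Q.1 - const_mx (Q.2 / 2)) (Q.1 + const_mx (Q.2 / 2)).
Proof.
by apply/seteqP; split => x xQ i; have := xQ i; rewrite !mxE ler_distl.
Qed.

Lemma volE Q : 0 <= Q.2 -> vol Q = Q.2 ^+ n.
Proof.
move=> Q0; rewrite /vol cube_set_box lebesgue_rV_box => [/=|i]; last first.
  by rewrite !mxE lerD2l -subr_ge0 opprK -splitr.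
under eq_bigr do rewrite !mxE opprD opprK addrACA subrr add0r -splitr.
by rewrite prodr_const card_ord.
Qed.

End john_nirenberg.

(* Main.v *)
Require Import Defs.
From mathcomp Require Import all_boot all_order all_algebra.
From mathcomp Require Import all_classical all_reals all_analysis.
From mathcomp Require Import measurable_realfun.
From mathcomp Require Import ring lra zify.
Import Order.TTheory GRing.Theory Num.Theory.
Import numFieldNormedType.Exports.
Local Open Scope classical_set_scope.
Local Open Scope ring_scope.
Set Implicit Arguments.
Unset Strict Implicit.
Unset Printing Implicit Defensive.

(** Write J(q) for the integral of |f - f_q| over a cube q.  The heart of the
proof is a bound of J(Q), for a single cube Q on which f is integrable, by a
sum of J(q) over finitely many cubes q of bounded overlap whose dilates by
lambda stay inside Q.

Bisect Q dyadically and stop at the cubes q with (4/3)q contained in Q.  Every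
cube q that is not stopped contributes the cube (3/4)q, which contains the
middle half of q and the middle halves of all its dyadic children, so J((3/4)q)
controls the difference of the means of f over these halves.  Comparing f with
the mean over the middle half of Q and telescoping down the tree, a
cube q is charged the factor |child| / |q| by each of its 2^n children, hence a
constant in total; no summation over chains is needed
([whitney_tree_L1dist]).  After k generations the points not covered by stopped
cubes lie in a thin layer along the boundary of Q, where the integral of
|f - c| is small ([L1dist_shrink]); one deep enough finite tree therefore
suffices.  A point x at distance d from the complement of Q only lies in cubes of
the family whose side is comparable to d, whence the bounded overlap ([whitney_tree_overlap]).

These cubes may be dilated by 4/3 only.  To reach a large lambda each of them
is cut into a grid of much smaller overlapping cubes, whose means are compared
along a path of neighbours ([grid_osc]).  The number of steps depends on lambda
and is absorbed by the constant, whereas the overlap of the grid, 3^n, does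
not; that is why the overlap bound can be chosen before lambda
([osc_le_local_family]).  A power mean inequality turns the bound into one for
the summands |q| (J(q) / |q|)^p, because bounded overlap makes the total volume
of the family comparable to |Q| ([energy_le_local_family]).

Finally, given finitely many cubes of an admissible partition, the families
found inside them sit in disjoint open cubes, so their union still has bounded
overlap.  It need not cover G, but adding the maximal dyadic cubes Q with
lambda Q contained in G makes it a local partition
([local_partition_extend]) and only increases the sum. *)

(** * Integrals of distances to constants *)

Section integrals.
Context d (T : measurableType d) (R : realType).
Variable mu : {measure set T -> \bar R}.
Implicit Types (A B D : set T) (f g : T -> R).

Lemma integrable_cst_fin A (c : R) : measurable A -> (mu A < +oo)%E ->
  mu.-integrable A (EFin \o cst c).
Proof.
move=> mA Aoo; apply/integrableP; split; first exact/measurable_EFinP.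
by rewrite (eq_integral (cst `|c|%:E))// integral_cst// lte_mul_pinfty.
Qed.

Lemma integrable_dist D f (c : R) : measurable D -> (mu D < +oo)%E ->
  mu.-integrable D (EFin \o f) ->
  mu.-integrable D (EFin \o (fun x => `|f x - c|)).
Proof.
move=> mD Doo fi.
have ci := integrable_cst_fin c mD Doo.
exact: (integrable_norm (integrableB mD fi ci)).
Qed.

Lemma le_Rintegral_subset D A B g : measurable D -> measurable A ->
  measurable B -> A `<=` B -> B `<=` D ->
  mu.-integrable D (EFin \o g) -> (forall x, 0 <= g x) ->
  \int[mu]_(x in A) g x <= \int[mu]_(x in B) g x.
Proof.
move=> mD mA mB AB BD gi g0.
have giB := integrableS mD mB BD gi.
rewrite -(setDUK AB) Rintegral_setU//.
- by rewrite lerDl Rintegral_ge0.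
- exact: measurableD.
- by rewrite setDUK.
- by apply/disj_setPS => x [? []].
Qed.

(** Subadditivity needs no disjointness, so closed cubes can be used throughout
without discussing their common faces. *)
Lemma le_Rintegral_cover (I : eqType) D A (B : I -> set T) (s : seq I) g :
  measurable D -> measurable A -> (forall i, i \in s -> measurable (B i)) ->
  A `<=` D -> (forall i, i \in s -> B i `<=` D) ->
  (forall x, A x -> exists2 i, i \in s & B i x) ->
  mu.-integrable D (EFin \o g) -> (forall x, 0 <= g x) ->
  \int[mu]_(x in A) g x <= \sum_(i <- s) \int[mu]_(x in B i) g x.
Proof.
move=> mD + + + + + gi g0; elim: s A => [|i s IH] A mA mB AD BD AB.
  rewrite big_nil (_ : A = set0) ?Rintegral_set0// -subset0 => x /AB[i].
  by rewrite in_nil.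
have mBi : measurable (B i) by apply: mB; rewrite mem_head.
rewrite big_cons -(setUIDK A (B i)) Rintegral_setU.
- apply: lerD.
    apply: (le_Rintegral_subset mD) => //; first exact: measurableI.
    by apply: BD; rewrite mem_head.
  apply: IH => [||x []/AD//||x [Ax nBx]].
  + exact: measurableD.
  + by move=> j js; apply: mB; rewrite in_cons js orbT.
  + by move=> j js; apply: BD; rewrite in_cons js orbT.
  + by have [j + Bj] := AB _ Ax; rewrite in_cons => /orP[/eqP ji|js];
      [rewrite ji in Bj|exists j].
- exact: measurableI.
- exact: measurableD.
- by rewrite setUIDK; exact: (integrableS mD).
- by apply/disj_setPS => x [[? ?] []].
Qed.

Lemma Rintegral_dist_shift A f (c c' : R) : measurable A -> (mu A < +oo)%E ->
  mu.-integrable A (EFin \o f) ->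
  \int[mu]_(x in A) `|f x - c| <=
  \int[mu]_(x in A) `|f x - c'| + fine (mu A) * `|c' - c|.
Proof.
move=> mA Aoo fi.
have ci := integrable_cst_fin `|c' - c| mA Aoo.
rewrite [_ * `| _ |]mulrC -Rintegral_cst// -RintegralD//; last first.
  exact: integrable_dist.
apply: le_Rintegral => //; first exact: integrable_dist.
  exact: (integrableD mA (integrable_dist c' mA Aoo fi) ci).
by move=> x _; rewrite -[f x - c](subrKA c') ler_normD.
Qed.

(** The mean of a constant is that constant, so this is the triangle inequality
for the integral of [f - c]. *)
Lemma mean_dist A f (c : R) : measurable A -> 0 < fine (mu A) ->
  mu.-integrable A (EFin \o f) ->
  `|(fine (mu A))^-1 * \int[mu]_(x in A) f x - c| <=
  (fine (mu A))^-1 * \int[mu]_(x in A) `|f x - c|.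
Proof.
move=> mA A0 fi.
have Aoo : (mu A < +oo)%E by rewrite ltey; apply: contraTneq A0 => ->; rewrite ltxx.
have ci := integrable_cst_fin c mA Aoo.
have -> : (fine (mu A))^-1 * \int[mu]_(x in A) f x - c =
    (fine (mu A))^-1 * \int[mu]_(x in A) (f x - c).
  rewrite RintegralB// Rintegral_cst// mulrBr; congr (_ - _).
  by rewrite mulrCA mulVf ?mulr1// gt_eqF.
rewrite normrM [X in X * _]ger0_norm ?invr_ge0 ?(ltW A0)//.
apply: ler_wpM2l; first by rewrite invr_ge0 (ltW A0).
apply: le_normr_Rintegral => //.
exact: (integrableB mA fi ci).
Qed.

Lemma Rintegral_abs_continuous D g (e : R) : measurable D ->
  mu.-integrable D (EFin \o g) -> (forall x, 0 <= g x) -> 0 < e ->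
  exists2 r : R, 0 < r & forall A, measurable A -> A `<=` D ->
    (mu A < r%:E)%E -> \int[mu]_(x in A) g x < e.
Proof.
move=> mD gi g0 e0.
have giT : mu.-integrable setT (EFin \o (g \_ D)).
  by rewrite -restrict_EFin; apply/integrable_restrict => //; rewrite setTI.
have [r [r0 H]] := integral_normr_continuous giT e0.
exists r => // A mA AD Ar; have := H A mA Ar.
rewrite (_ : \int[mu]_(x in A) `|(g \_ D) x| = \int[mu]_(x in A) g x)//.
apply: eq_Rintegral => x /set_mem Ax.
by rewrite patchE mem_set ?ger0_norm//; exact: AD.
Qed.

(** Integrate the inequality between the sum of the indicator functions and
[M]. *)
Lemma sum_measure_overlap (I : Type) (s : seq I) (B : I -> set T) D (M : nat) :
  (forall i, measurable (B i)) -> (forall i, B i `<=` D) -> measurable D ->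
  (mu D < +oo)%E ->
  (forall x, (count (fun i => x \in B i) s <= M)%N) ->
  \sum_(i <- s) fine (mu (B i)) <= M%:R * fine (mu D).
Proof.
move=> mB BD mD Doo cM.
have Boo i : (mu (B i) < +oo)%E.
  by apply: le_lt_trans Doo; apply: le_measure; rewrite ?inE.
rewrite -lee_fin EFinM -sumEFin.
under eq_bigr do rewrite fineK ?ge0_fin_numE//.
rewrite fineK ?ge0_fin_numE//.
under eq_bigr => i _ do rewrite -(setIidl (BD i)) -integral_indic//.
rewrite -ge0_integral_sum//; last first.
  by move=> i; apply/measurable_EFinP; exact: measurable_indic.
rewrite -integral_cst//; apply: ge0_le_integral => //.
- by move=> x _; rewrite sume_ge0.
- apply: emeasurable_sum => i.
  by apply/measurable_EFinP; exact: measurable_indic.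
- move=> x _; rewrite /= sumEFin lee_fin.
  under eq_bigr do rewrite indicE.
  rewrite -natr_sum ler_nat; apply: leq_trans (cM x).
  by rewrite -sum1_count [leqRHS]big_mkcond; apply: leq_sum => i _; case: ifP.
Qed.

End integrals.

(** * Means and oscillations over cubes *)

(** A crude Lipschitz bound on the volume of a cube as a function of its side;
only its linear dependence on [h] matters. *)
Lemma exprn_shrink_le (R : realFieldType) (n : nat) (s h : R) : 0 <= h -> h <= s ->
  s ^+ n - (s - h) ^+ n <= h * n%:R * (1 + s) ^+ n.
Proof.
move=> h0 hs; have s0 := le_trans h0 hs; elim: n => [|n IH].
  by rewrite !expr0 subrr mulr0 mul0r.
have -> : s ^+ n.+1 - (s - h) ^+ n.+1 =
  s * (s ^+ n - (s - h) ^+ n) + h * (s - h) ^+ n by rewrite !exprS; ring.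
have H1 : (s - h) ^+ n <= (1 + s) ^+ n.
  by rewrite lerXn2r ?nnegrE ?subr_ge0 ?addr_ge0//; lra.
have Y0 : 0 <= (1 + s) ^+ n by rewrite exprn_ge0// addr_ge0.
apply: le_trans (lerD (ler_wpM2l s0 IH) (ler_wpM2l h0 H1)) _.
rewrite exprS -natr1 -subr_ge0.
rewrite (_ : _ - _ = h * (n%:R + s) * (1 + s) ^+ n); last by ring.
by rewrite !mulr_ge0// addr_ge0.
Qed.

Section cubes.
Context {R : realType} {n : nat}.
Implicit Types (Q q : 'rV[R]_n * R) (A B D : set 'rV[R]_n) (f : 'rV[R]_n -> R).

(** Measurability for the completed measure, whose sigma-algebra lives on an
alias of the type of row vectors. *)
Definition lebesgue_measurable A : Prop :=
  @measurable _ (caratheodory_type (mu_ext (product_lebesgue R n))) A.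

Lemma measurable_cube Q : lebesgue_measurable (cube_set Q).
Proof.
rewrite cube_set_box; apply: sub_caratheodory; apply: sub_sigma_algebra.
exact: measurable_box.
Qed.

Lemma lebesgue_cube Q : 0 <= Q.2 -> lebesgue_rV R n (cube_set Q) = (Q.2 ^+ n)%:E.
Proof.
move=> Q0; rewrite -volE// /vol cube_set_box lebesgue_rV_box// => i.
by rewrite !mxE lerD2l -subr_ge0 opprK -splitr.
Qed.

Lemma cube_lt_pinfty Q : 0 <= Q.2 -> (lebesgue_rV R n (cube_set Q) < +oo)%E.
Proof. by move=> Q0; rewrite lebesgue_cube// ltry. Qed.

Lemma L1_subset A D f : lebesgue_measurable A -> lebesgue_measurable D ->
  A `<=` D -> L1 D f -> L1 A f.
Proof. by move=> mA mD AD; exact: integrableS. Qed.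

Lemma cube_subset q Q :
  (forall i, `|q.1 ord0 i - Q.1 ord0 i| + q.2 / 2 <= Q.2 / 2) ->
  cube_set q `<=` cube_set Q.
Proof.
move=> qQ x xq i; apply: le_trans (qQ i).
rewrite -(subrKA (q.1 ord0 i)) addrC.
by rewrite (le_trans (ler_normD _ _))// lerD2l xq.
Qed.

Definition L1dist A f (c : R) : R := \int[lebesgue_rV R n]_(x in A) `|f x - c|.

(** Not divided by the volume: in this normalisation oscillations are simply
added up over a family of cubes. *)
Definition osc Q f : R := L1dist (cube_set Q) f (avg Q f).

Lemma L1dist_ge0 A f c : 0 <= L1dist A f c.
Proof. exact: Rintegral_ge0. Qed.

Lemma osc_ge0 Q f : 0 <= osc Q f.
Proof. exact: L1dist_ge0. Qed.

Lemma avg_oscE Q f : avg Q (fun x => `|f x - avg Q f|) = (vol Q)^-1 * osc Q f.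
Proof. by []. Qed.

(** The mean over a subcube [q] is as good a substitute for [c] as the ratio of
the volumes allows; applied to two subcubes of one cube [Q], with [c] the mean
over [Q], it compares their means. *)
Lemma avg_dist q Q f c : 0 < q.2 -> 0 <= Q.2 -> cube_set q `<=` cube_set Q ->
  L1 (cube_set Q) f ->
  `|avg q f - c| <= (q.2 ^+ n)^-1 * L1dist (cube_set Q) f c.
Proof.
move=> q0 Q0 qQ fi.
have fiq := L1_subset (measurable_cube q) (measurable_cube Q) qQ fi.
have vq : 0 < vol q by rewrite volE ?exprn_gt0// ltW.
rewrite -volE ?(ltW q0)//.
apply: (le_trans (mean_dist c (measurable_cube q) vq fiq)).
apply: ler_wpM2l; first by rewrite invr_ge0 ltW.
apply: (le_Rintegral_subset (measurable_cube Q)) => //.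
- exact: measurable_cube.
- exact: measurable_cube.
- apply: integrable_dist => //; first exact: measurable_cube.
  exact: cube_lt_pinfty.
Qed.

Lemma L1dist_shift A Q f (c c' : R) : lebesgue_measurable A -> 0 <= Q.2 ->
  A `<=` cube_set Q -> L1 (cube_set Q) f ->
  L1dist A f c <= L1dist A f c' + Q.2 ^+ n * `|c' - c|.
Proof.
move=> mA Q0 AQ fi.
have muAQ : (lebesgue_rV R n A <= lebesgue_rV R n (cube_set Q))%E.
  by apply: le_measure; rewrite ?inE//; exact: measurable_cube.
have Aoo : (lebesgue_rV R n A < +oo)%E.
  by apply: le_lt_trans muAQ _; exact: cube_lt_pinfty.
have fiA := L1_subset mA (measurable_cube Q) AQ fi.
apply: (le_trans (Rintegral_dist_shift c c' mA Aoo fiA)).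
rewrite lerD2l ler_wpM2r// -lee_fin fineK ?ge0_fin_numE//.
by rewrite -lebesgue_cube.
Qed.

(** Up to a factor 2 the mean is the best constant. *)
Lemma osc_le_L1dist Q f c : 0 < Q.2 -> L1 (cube_set Q) f ->
  osc Q f <= 2 * L1dist (cube_set Q) f c.
Proof.
move=> Q0 fi; apply: le_trans.
  exact: (L1dist_shift (avg Q f) c (measurable_cube Q) (ltW Q0) _ fi).
rewrite mulr2n mulrDl mul1r lerD2l distrC.
have := avg_dist c Q0 (ltW Q0) (@subset_refl _ _) fi.
by rewrite -ler_pdivlMl ?invr_gt0 ?exprn_gt0// invrK.
Qed.

Lemma L1dist_subset Q A B f c : 0 <= Q.2 -> lebesgue_measurable A ->
  lebesgue_measurable B -> A `<=` B -> B `<=` cube_set Q ->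
  L1 (cube_set Q) f -> L1dist A f c <= L1dist B f c.
Proof.
move=> Q0 mA mB AB BQ fi.
apply: (le_Rintegral_subset (measurable_cube Q)) => //.
by apply: integrable_dist => //; [exact: measurable_cube|exact: cube_lt_pinfty].
Qed.

Lemma L1dist_cover (I : eqType) (s : seq I) (B : I -> set 'rV[R]_n) Q A f c :
  0 <= Q.2 -> lebesgue_measurable A ->
  (forall i, i \in s -> lebesgue_measurable (B i)) ->
  A `<=` cube_set Q -> (forall i, i \in s -> B i `<=` cube_set Q) ->
  (forall x, A x -> exists2 i, i \in s & B i x) ->
  L1 (cube_set Q) f ->
  L1dist A f c <= \sum_(i <- s) L1dist (B i) f c.
Proof.
move=> Q0 mA mB AQ BQ AB fi.
apply: (le_Rintegral_cover (measurable_cube Q)) => //.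
by apply: integrable_dist => //; [exact: measurable_cube|exact: cube_lt_pinfty].
Qed.

(** The layer between two concentric cubes has small measure when their sides
are close, so the integral over it is at most half of the total by absolute
continuity of the integral. *)
Lemma L1dist_shrink Q f c : 0 < Q.2 -> L1 (cube_set Q) f ->
  exists2 eta : R, 0 < eta &
    L1dist (cube_set Q) f c <= 2 * L1dist (cube_set (Q.1, Q.2 - 2 * eta)) f c.
Proof.
move=> Q0 fi.
have := L1dist_ge0 (cube_set Q) f c; rewrite le_eqVlt => /predU1P[<-|I0].
  by exists 1 => //; rewrite mulr_ge0// L1dist_ge0.
have gi : (lebesgue_rV R n).-integrable (cube_set Q)
    (EFin \o (fun x => `|f x - c|)).
  by apply: integrable_dist => //; [exact: measurable_cube|exact/cube_lt_pinfty/ltW].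
have I2 : 0 < L1dist (cube_set Q) f c / 2 by rewrite divr_gt0.
have [r r0 Hr] := Rintegral_abs_continuous (measurable_cube Q) gi (fun=> normr_ge0 _) I2.
pose X := n.+1%:R * (1 + Q.2) ^+ n.
have X0 : 0 < X by rewrite mulr_gt0// exprn_gt0// addr_gt0.
pose h := Num.min Q.2 (r / X).
have h0 : 0 < h by rewrite lt_min Q0 divr_gt0.
have hQ : h <= Q.2 by rewrite ge_min lexx.
have hX : h * X <= r by rewrite -ler_pdivlMr// ge_min lexx orbT.
exists (h / 2); first by rewrite divr_gt0.
rewrite [2 * (h / 2)]mulrC divfK//.
set Q' := (Q.1, Q.2 - h).
have Q'0 : 0 <= Q'.2 by rewrite subr_ge0.
have mQ := measurable_cube Q; have mQ' := measurable_cube Q'.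
have Q'Q : cube_set Q' `<=` cube_set Q.
  by apply: cube_subset => i; rewrite subrr normr0 add0r ler_pM2r// gerBl ltW.
pose A := cube_set Q `\` cube_set Q'.
have mA : lebesgue_measurable A by exact: measurableD.
have Ar : (lebesgue_rV R n A < r%:E)%E.
  have -> : lebesgue_rV R n A =
      (lebesgue_rV R n (cube_set Q) - lebesgue_rV R n (cube_set Q'))%E.
    have := measureD mQ mQ' (cube_lt_pinfty (ltW Q0)).
    by rewrite (_ : _ `&` _ = cube_set Q'); last exact/setIidr.
  rewrite (lebesgue_cube (ltW Q0)) (lebesgue_cube Q'0) -EFinB lte_fin.
  apply: le_lt_trans (exprn_shrink_le n (ltW h0) hQ) _.
  apply: lt_le_trans hX; rewrite -mulrA ltr_pM2l// ltr_pM2r ?ltr_nat//.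
  by rewrite exprn_gt0// addr_gt0.
have := Hr A mA (@subDsetl _ _ _) Ar; rewrite -/(L1dist A f c) => IA.
have := @L1dist_cover _ [:: cube_set Q'; A] id Q (cube_set Q) f c (ltW Q0) mQ.
rewrite big_cons big_seq1 => /(_ _ _ _ _ fi) H.
have {H} : L1dist (cube_set Q) f c <= L1dist (cube_set Q') f c + L1dist A f c.
  apply: H => //.
  - by move=> B; rewrite !inE => /orP[]/eqP->.
  - by move=> B; rewrite !inE => /orP[]/eqP-> //; exact: subDsetl.
  - move=> x Qx; have [Q'x|nQ'x] := pselect (cube_set Q' x).
      by exists (cube_set Q') => //; rewrite mem_head.
    by exists A; rewrite // !inE eqxx orbT.
by move: IA; lra.
Qed.

End cubes.

(** * The tree of bisections stopped away from the boundary *)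

Section tree.
Context {R : realType} {n : nat}.
Implicit Types (Q q S : 'rV[R]_n * R) (f : 'rV[R]_n -> R) (x : 'rV[R]_n).

(** Inclusion of [cube_set q] in [cube_set Q], read off the coordinates so that
it is a boolean and reduces to linear arithmetic. *)
Definition inside q Q : bool :=
  [forall i, `|q.1 ord0 i - Q.1 ord0 i| + q.2 / 2 <= Q.2 / 2].

Lemma insideP q Q :
  reflect (forall i, `|q.1 ord0 i - Q.1 ord0 i| + q.2 / 2 <= Q.2 / 2)
    (inside q Q).
Proof. exact: forallP. Qed.

Lemma inside_subset q Q : inside q Q -> cube_set q `<=` cube_set Q.
Proof. by move/insideP/cube_subset. Qed.

Lemma inside_trans S q Q : inside q S -> inside S Q -> inside q Q.
Proof.
move=> /insideP qS /insideP SQ; apply/insideP => i.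
have := ler_distD (S.1 ord0 i) (q.1 ord0 i) (Q.1 ord0 i).
by move: (qS i) (SQ i); lra.
Qed.

Lemma inside_dilate (a b : R) Q : 0 <= Q.2 -> a <= b ->
  inside (dilate a Q) (dilate b Q).
Proof.
move=> Q0 ab; apply/insideP => i /=; rewrite subrr normr0 add0r.
by rewrite ler_pM2r// ler_wpM2r.
Qed.

Lemma dilate1 Q : dilate 1 Q = Q.
Proof. by case: Q => c s; rewrite /dilate mul1r. Qed.

Lemma inside_shrink (a : R) Q : 0 <= Q.2 -> a <= 1 -> inside (dilate a Q) Q.
Proof. by move=> Q0 a1; rewrite -[X in inside _ X]dilate1 inside_dilate. Qed.

Lemma inside_refl Q : inside Q Q.
Proof. by apply/insideP => i; rewrite subrr normr0 add0r. Qed.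

(** The dyadic children are indexed by the sign of each coordinate of the
displacement of their centre. *)
Definition child Q (e : {ffun 'I_n -> bool}) : 'rV[R]_n * R :=
  (Q.1 + \row_i ((-1) ^+ e i * (Q.2 / 4)), Q.2 / 2).

Lemma child_inside Q e : 0 <= Q.2 -> inside (child Q e) Q.
Proof.
move=> Q0; apply/insideP => i; rewrite !mxE addrAC subrr add0r.
rewrite normrM normrX normrN1 expr1n mul1r ger0_norm ?divr_ge0//=; lra.
Qed.

Lemma child_cover Q x : cube_set Q x -> exists e, cube_set (child Q e) x.
Proof.
move=> Qx; exists [ffun i => x ord0 i < Q.1 ord0 i] => i.
have := Qx i; rewrite !mxE ffunE /=.
rewrite !ler_distlC; case: ltP => xi /andP[? ?]; apply/andP; split.
all: by rewrite ?expr0 ?expr1; lra.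
Qed.

(** Cubes that are neither stopped nor bisected any further, those of the last
generation close to the boundary, are dropped. *)
Fixpoint whitney_tree Q0 k Q : seq ('rV[R]_n * R) :=
  if inside (dilate (4 / 3) Q) Q0 then [:: Q] else
  if k is k'.+1 then
    dilate (3 / 4) Q ::
      flatten [seq whitney_tree Q0 k' (child Q e) | e <- enum {ffun 'I_n -> bool}]
  else [::].

Lemma whitney_tree_inside Q0 k Q q : 0 < Q.2 -> q \in whitney_tree Q0 k Q ->
  0 < q.2 /\ inside q Q.
Proof.
elim: k Q => [|k IH] Q Qp /=; case: ifP => // _.
- by rewrite inE => /eqP ->; split=> //; exact: inside_refl.
- by rewrite inE => /eqP ->; split=> //; exact: inside_refl.
rewrite inE => /predU1P[->|].
  split; first by rewrite /= mulr_gt0.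
  by apply: inside_shrink; [exact: ltW|lra].
move=> /flatten_mapP[e _ /IH[|q0 qe]]; first by rewrite /= divr_gt0.
by split=> //; apply: inside_trans qe _; exact/child_inside/ltW.
Qed.

(** For the cubes that are not stopped this holds because 4/3 of 3/4 is 1. *)
Lemma whitney_tree_local Q0 k Q q : 0 < Q.2 -> inside Q Q0 ->
  q \in whitney_tree Q0 k Q -> inside (dilate (4 / 3) q) Q0.
Proof.
elim: k Q => [|k IH] Q Qp QQ0 /=; case: ifP => // far.
- by rewrite inE => /eqP ->.
- by rewrite inE => /eqP ->.
rewrite inE => /predU1P[->|].
  by rewrite (_ : dilate _ _ = Q)//; case: Q {far QQ0 Qp} => c s; congr (_, _) => /=; field.
move=> /flatten_mapP[e _ /IH]; apply; first by rewrite /= divr_gt0.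
by apply: inside_trans QQ0; exact/child_inside/ltW.
Qed.

Let half Q := dilate (1 / 2) Q.

(** The induction runs over all cubes of the tree, which is why [f] is compared
with the mean over the middle half of the current cube [Q].  Intersecting with
the shrunken cube removes what the dropped cubes of the last generation would
contribute: by the bound on [7 / 6 * Q.2] none of them meets it.  In the
inductive step passing from the middle half of a child to that of [Q] costs
[2 * 2 ^+ n] times the oscillation over [B], for each of the [2 ^ n]
children. *)
Lemma whitney_tree_L1dist Q0 k Q f (eta : R) : 0 < Q.2 -> 0 < Q0.2 ->
  inside Q Q0 -> 7 / 6 * Q.2 <= 2 ^+ k * eta -> L1 (cube_set Q0) f ->
  L1dist (cube_set Q `&` cube_set (Q0.1, Q0.2 - 2 * eta)) f (avg (half Q) f) <=
  (2 * 4 ^+ n) * \sum_(q <- whitney_tree Q0 k Q) osc q f.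
Proof.
move=> Qp Q0p QQ0 etaQ fi.
have {etaQ} : 7 / 6 * Q.2 <= 2 ^+ k * eta by [].
set K := cube_set (Q0.1, _).
have mK : lebesgue_measurable K by exact: measurable_cube.
have mQK S : lebesgue_measurable (cube_set S `&` K).
  by apply: measurableI => //; exact: measurable_cube.
have fiS S : inside S Q0 -> L1 (cube_set S) f.
  by move=> /inside_subset SQ0; apply: L1_subset fi => //; exact: measurable_cube.
have half_in S : 0 < S.2 -> inside (half S) S.
  by move=> Sp; apply: inside_shrink; [exact: ltW|lra].
have farP S : 0 < S.2 -> inside S Q0 ->
    L1dist (cube_set S `&` K) f (avg (half S) f) <=
    (2 * 4 ^+ n) * osc S f.
  move=> Sp SQ0; have S0 := ltW Sp.
  have IS : L1dist (cube_set S `&` K) f (avg (half S) f) <=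
      L1dist (cube_set S) f (avg (half S) f).
    apply: (@L1dist_subset R n Q0 _ _ f _ (ltW Q0p) (mQK S) (measurable_cube S) _ _ fi).
      exact: subIsetl.
    exact: inside_subset.
  apply: le_trans IS _.
  apply: le_trans (L1dist_shift _ (avg S f) (measurable_cube S) S0 _ (fiS S SQ0)) _ => //.
  have hp : 0 < (half S).2 by rewrite /= mulr_gt0.
  have := avg_dist (avg S f) hp S0 (inside_subset (half_in S Sp)) (fiS S SQ0).
  rewrite distrC -/(osc S f) => H.
  have {}H := ler_wpM2l (exprn_ge0 n S0) H.
  apply: le_trans (lerD (lexx _) H) _.
  rewrite mulrA -exprVn -exprMn /= (_ : S.2 * (1 / 2 * S.2)^-1 = 2); last by field; rewrite gt_eqF.
  have : (1 : R) <= 2 ^+ n by rewrite exprn_ege1// ler1n.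
  have : (2 : R) ^+ n <= 4 ^+ n by rewrite lerXn2r ?nnegrE ?ler_nat.
  have := osc_ge0 S f; rewrite /L1dist -/(osc S f); nra.
elim: k Q Qp QQ0 => [|k IH] Q Qp QQ0 /=; case: ifP => [|/negbT] far etaQ.
- by rewrite big_seq1; exact: farP.
- rewrite big_nil mulr0 (_ : _ `&` _ = set0) ?/L1dist ?Rintegral_set0//.
  rewrite -subset0 => x [Qx Kx].
  move: far; rewrite negb_forall => /existsP[i]; rewrite -ltNge /=.
  have := ler_distD (x ord0 i) (Q.1 ord0 i) (Q0.1 ord0 i).
  move: (Qx i) (Kx i) etaQ; rewrite /= expr0 (distrC (Q.1 ord0 i) (x ord0 i)).
  by lra.
- by rewrite big_seq1; exact: farP.
have Q_0 := ltW Qp.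
pose B := dilate (3 / 4) Q.
have BQ : inside B Q by apply: inside_shrink => //; lra.
have Bp : 0 < B.2 by rewrite /= mulr_gt0.
have hp : 0 < (half Q).2 by rewrite /= mulr_gt0.
have BQ0 := inside_trans BQ QQ0.
have chp e : 0 < (child Q e).2 by rewrite /= divr_gt0.
have chQ0 e : inside (child Q e) Q0 by apply: inside_trans QQ0; exact: child_inside.
have hB : inside (half Q) B by apply: inside_dilate => //; lra.
have hcB e : inside (half (child Q e)) B.
  apply/insideP => i; rewrite !mxE addrAC subrr add0r.
  rewrite normrM normrX normrN1 expr1n mul1r ger0_norm ?divr_ge0//=; lra.
(* The factor 2 bounds 1 + 2^-n: the half of the child has volume (Q.2/4)^n
   and that of Q has volume (Q.2/2)^n, against (Q.2/2)^n for the child. *)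
have step e : L1dist (cube_set (child Q e) `&` K) f (avg (half Q) f) <=
    (2 * 4 ^+ n) * (\sum_(q <- whitney_tree Q0 k (child Q e)) osc q f) +
    2 * 2 ^+ n * osc B f.
  have HI := IH (child Q e) (chp e) (chQ0 e).
  apply: le_trans (L1dist_shift (avg (half Q) f) (avg (half (child Q e)) f)
     (mQK _) (ltW (chp e)) (@subIsetl _ _ _) (fiS _ (chQ0 e))) _.
  apply: lerD.
    by apply: HI; move: etaQ; rewrite exprS /=; lra.
  have hcp : 0 < (half (child Q e)).2 by rewrite /= mulr_gt0// divr_gt0.
  have H1 := avg_dist (avg B f) hcp (ltW Bp) (inside_subset (hcB e)) (fiS _ BQ0).
  have H2 := avg_dist (avg B f) hp (ltW Bp) (inside_subset hB) (fiS _ BQ0).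
  have H3 := ler_distD (avg B f) (avg (half (child Q e)) f) (avg (half Q) f).
  rewrite (distrC (avg B f)) in H3.
  have {}H3 := le_trans H3 (lerD H1 H2).
  have {}H3 := ler_wpM2l (exprn_ge0 n (ltW (chp e))) H3.
  apply: le_trans H3 _; rewrite -/(osc B f) -mulrDl mulrA ler_wpM2r ?osc_ge0//.
  rewrite mulrDr -!exprVn -!exprMn /=.
  rewrite (_ : _ * (1 / 2 * (Q.2 / 2))^-1 = 2); last by field; rewrite gt_eqF.
  rewrite (_ : _ * (1 / 2 * Q.2)^-1 = 1); last by field; rewrite gt_eqF.
  by rewrite expr1n mulr_natl [_ ^+ n *+ 2]mulr2n lerD2l exprn_ege1// ler1n.
pose s := enum {ffun 'I_n -> bool}.
have : L1dist (cube_set Q `&` K) f (avg (half Q) f) <=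
   \sum_(e <- s) L1dist (cube_set (child Q e) `&` K) f (avg (half Q) f).
  apply: (@L1dist_cover R n _ s (fun e => cube_set (child Q e) `&` K) Q0
    (cube_set Q `&` K) f _ (ltW Q0p) (mQK Q) (fun e _ => mQK (child Q e))
    _ _ _ fi).
  - by move=> x [/(inside_subset QQ0)].
  - by move=> e _ x [/(inside_subset (chQ0 e))].
  - by move=> x [/child_cover[e Qe] Kx]; exists e; rewrite ?mem_enum.
move=> /le_trans; apply.
rewrite big_cons big_flatten big_map -/B.
apply: le_trans (ler_sum _ (fun e _ => step e)) _.
rewrite big_split /= mulrDr addrC -!mulr_sumr; apply: lerD => //.
rewrite big_const_seq count_predT -cardE card_ffun card_bool card_ord.
have -> : (4 : R) = 2 * 2 by rewrite -natrM.
by rewrite iter_addr_0 -[osc _ _ *+ _]mulr_natl natrX exprMn !mulrA.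
Qed.

End tree.

(** * Overlap of the tree *)

Section overlap.
Context {R : realType} {n : nat}.
Implicit Types (Q q : 'rV[R]_n * R) (x y : 'rV[R]_n).

Definition open_cube Q : set 'rV[R]_n :=
  [set x | forall i, `|x ord0 i - Q.1 ord0 i| < Q.2 / 2].

Lemma inside_open q Q : inside q Q -> open_cube q `<=` open_cube Q.
Proof.
move=> /insideP qQ x xq i; have := qQ i; have := xq i.
have := ler_distD (q.1 ord0 i) (x ord0 i) (Q.1 ord0 i); lra.
Qed.

Lemma open_cube_sub Q : open_cube Q `<=` cube_set Q.
Proof. by move=> x xQ i; exact/ltW. Qed.

(** Overlaps are easier to count on open cubes, which can be disjoint.  A closed
cube containing [x] has one of the [2 ^ n] points [move_to e], obtained by
moving [x] slightly along a diagonal direction towards the centre, in its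
interior; the displacement can be the same for the finitely many cubes. *)
Lemma closed_overlap (s : seq ('rV[R]_n * R)) (K : nat) :
  (forall Q, Q \in s -> 0 < Q.2) ->
  (forall y, (count (fun Q => y \in open_cube Q) s <= K)%N) ->
  forall x, (count (fun Q => x \in cube_set Q) s <= 2 ^ n * K)%N.
Proof.
move=> s0 sK x.
have [t t0 ts] : exists2 t : R, 0 < t & forall Q, Q \in s -> t < Q.2.
  elim: s s0 {sK} => [|Q s IH] s0; first by exists 1.
  have [|t t0 ts] := IH; first by move=> q qs; apply: s0; rewrite in_cons qs orbT.
  have Qp : 0 < Q.2 by apply: s0; rewrite mem_head.
  exists (Num.min t (Q.2 / 2)); first by rewrite lt_min t0 divr_gt0.
  move=> q; rewrite in_cons => /predU1P[->|/ts]; rewrite gt_min.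
    by apply/orP; right; lra.
  by move=> ->.
pose move_to (e : {ffun 'I_n -> bool}) := x + \row_i ((-1) ^+ e i * (t / 2)).
apply: (@leq_trans (\sum_(e : {ffun 'I_n -> bool})
    count (fun Q => move_to e \in open_cube Q) s)); last first.
  apply: leq_trans (leq_sum _ (fun e _ => sK (move_to e))) _.
  by rewrite sum_nat_const card_ffun card_bool card_ord.
elim: s s0 ts {sK} => [|Q s IH] s0 ts /=; first by rewrite leq0n.
rewrite big_split /= leq_add//; last first.
  by apply: IH => q qs; [apply: s0|apply: ts]; rewrite in_cons qs orbT.
have [|//] := boolP (x \in cube_set Q); rewrite inE => xQ.
pose e := [ffun i => Q.1 ord0 i < x ord0 i].
have Qe : move_to e \in open_cube Q.
  rewrite inE => i; have := xQ i; have := ts Q (mem_head _ _).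
  rewrite !mxE ffunE ler_distl ltr_distl => tQ /andP[H1 H2].
  by apply/andP; split; case: (ltP (Q.1 ord0 i) (x ord0 i)) => H; rewrite ?expr0 ?expr1; lra.
by rewrite (bigD1 e)//= Qe.
Qed.

(** The open children are disjoint, so only the subtree of one child can contain
cubes whose interior meets [x]. *)
Lemma count_children Q0 k Q x (c : nat) : 0 < Q.2 ->
  (forall e, count (fun q => x \in open_cube q)
     (whitney_tree Q0 k (child Q e)) <= c)%N ->
  (count (fun q => x \in open_cube q)
     (flatten [seq whitney_tree Q0 k (child Q e) | e <- enum {ffun 'I_n -> bool}])
   <= c)%N.
Proof.
move=> Qp cc; pose e0 := [ffun i => x ord0 i < Q.1 ord0 i].
rewrite count_flatten sumnE 2!big_map big_enum /= (bigD1 e0)//=.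
rewrite big1 ?addn0// => e ee0; apply/eqP; rewrite -leqn0 leqNgt -has_count.
apply: contra ee0 => /hasP[q qe]; rewrite inE => xq.
have [|_ /inside_open/(_ x xq) xe] := whitney_tree_inside _ qe.
  by rewrite /= divr_gt0.
apply/eqP/ffunP => i; rewrite ffunE; have := xe i.
rewrite !mxE /= ltr_distl; case: (e i); rewrite ?expr0 ?expr1 => /andP[? ?].
  by apply/esym; lra.
by apply/esym/negbTE; rewrite -leNgt; lra.
Qed.

(** The point [x] is at distance at least [delta] from the complement of [Q0].  A
cube containing [x] of side at most 6/7 of [delta] is stopped, so there are at
most [m] bisections along the branch of [x] before the stopped cube. *)
Lemma whitney_tree_depth Q0 (delta : R) (m k : nat) Q x : 0 < Q.2 ->
  cube_set (Q0.1, Q0.2 - 2 * delta) x -> 7 / 6 * Q.2 <= 2 ^+ m * delta ->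
  (count (fun q => x \in open_cube q) (whitney_tree Q0 k Q) <= m.+1)%N.
Proof.
move=> + xd; elim: m k Q => [|m IH] [|k] Q Qp Qd; rewrite /=.
- by case: ifP => _ //=; case: (_ \in _).
- case: ifP => [|/negbT far]; first by move=> _ /=; case: (_ \in _).
  have xQ : ~ cube_set Q x.
    move=> Qx; move: far; rewrite negb_forall => /existsP[i]; rewrite -ltNge /=.
    have := ler_distD (x ord0 i) (Q.1 ord0 i) (Q0.1 ord0 i).
    move: (Qx i) (xd i) Qd; rewrite /= expr0 (distrC (Q.1 ord0 i) (x ord0 i)).
    lra.
  apply: (@leq_trans 0%N) => //; rewrite leqNgt -has_count.
  apply/negP => /hasP[q]; rewrite in_cons => qt; rewrite inE => xq.
  have qQ : inside q Q.
    have := @whitney_tree_inside R n Q0 k.+1 Q q Qp.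
    by rewrite /= (negbTE far) in_cons => /(_ qt)[].
  by apply: xQ; exact/(inside_subset qQ)/open_cube_sub.
- by case: ifP => _ //=; case: (_ \in _).
- case: ifP => [|/negbT far]; first by move=> _ /=; case: (_ \in _).
  rewrite /= -[m.+2]add1n leq_add//; first by case: (_ \in _).
  apply: count_children => // e; apply: IH; first by rewrite /= divr_gt0.
  by move: Qd; rewrite exprS /=; lra.
Qed.

(** The first cube on the branch of [x] for which [x] lies in [(3 / 4) Q] has
side at most 8 times the distance from [x] to the complement of [Q0]; four
bisections later the branch has stopped, as 7/6 * 8 is at most 2^4. *)
Lemma whitney_tree_overlap Q0 k Q x : 0 < Q.2 -> inside Q Q0 ->
  (count (fun q => x \in cube_set q) (whitney_tree Q0 k Q) <= 2 ^ n * 5)%N.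
Proof.
move=> Qp QQ0; apply: closed_overlap.
  by move=> q /(whitney_tree_inside Qp)[].
move=> {}x; elim: k Q Qp QQ0 => [|k IH] Q Qp QQ0.
  by rewrite /=; case: ifP => _ //=; case: (_ \in _).
have [xB|xB] := boolP (x \in open_cube (dilate (3 / 4) Q)).
  apply: (@whitney_tree_depth Q0 (Q.2 / 8)) => //; last first.
    by rewrite (_ : 2 ^+ 4 = 16); [lra|rewrite -natrX].
  move: xB; rewrite inE => xB i; move/insideP: QQ0 => /(_ i).
  have := xB i; have := ler_distD (Q.1 ord0 i) (x ord0 i) (Q0.1 ord0 i).
  by rewrite /=; lra.
rewrite /=; case: ifP => _ /=; first by case: (_ \in _).
rewrite (negbTE xB) add0n; apply: count_children => // e.
apply: IH; first by rewrite /= divr_gt0.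
by apply: inside_trans QQ0; exact/child_inside/ltW.
Qed.

End overlap.

(** * Cutting a cube into a grid of overlapping cubes *)

Section grid.
Context {R : realType} {n : nat}.
Implicit Types (Q q : 'rV[R]_n * R) (x : 'rV[R]_n) (f : 'rV[R]_n -> R).

(** With [u] the side of a cell when [Q] is cut into [m.+2 ^ n] cells, the grid
cubes are the blocks of [2 ^ n] adjacent cells, and [i] is the lowest cell of
the block; neighbouring blocks overlap in at least one cell. *)
Definition grid_cube (m : nat) Q (i : {ffun 'I_n -> 'I_m.+1}) : 'rV[R]_n * R :=
  let u := Q.2 / m.+2%:R in
  (Q.1 + \row_l (- (Q.2 / 2) + (i l).+1%:R * u), 2 * u).

Definition grid m Q := [seq grid_cube Q i | i <- enum {ffun 'I_n -> 'I_m.+1}].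

Lemma mem_grid m Q q : q \in grid m Q -> exists i, q = @grid_cube m Q i.
Proof. by move=> /mapP[i _ ->]; exists i. Qed.

Lemma grid_cube_gt0 m Q i : 0 < Q.2 -> 0 < (@grid_cube m Q i).2.
Proof. by move=> Qp; rewrite /= mulr_gt0// divr_gt0. Qed.

Lemma grid_cube_inside m Q i : 0 < Q.2 -> inside (@grid_cube m Q i) Q.
Proof.
move=> Qp; apply/insideP => l; rewrite !mxE /= addrAC subrr add0r.
set u := Q.2 / m.+2%:R; have u0 : 0 < u by rewrite divr_gt0.
have Qu : Q.2 = m.+2%:R * u by rewrite mulrC divfK// pnatr_eq0.
have H : ((i l).+1%:R : R) <= m.+1%:R by rewrite ler_nat ltn_ord.
have {H} := ler_wpM2r (ltW u0) H.
have : 1 * u <= (i l).+1%:R * u by rewrite ler_pM2r// ler1n.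
rewrite Qu -[m.+2%:R]natr1 => H1 H2; rewrite -lerBrDr ler_norml.
by apply/andP; split; lra.
Qed.

Lemma grid_cube_local m Q i (lambda : R) : 0 < Q.2 -> 6 * lambda <= m.+2%:R ->
  inside (dilate lambda (@grid_cube m Q i)) (dilate (4 / 3) Q).
Proof.
move=> Qp lm; apply/insideP => l; have /insideP/(_ l) := grid_cube_inside i Qp.
rewrite /= !mxE; set u := Q.2 / m.+2%:R; have u0 : 0 < u by rewrite divr_gt0.
have Qu : Q.2 = m.+2%:R * u by rewrite mulrC divfK// pnatr_eq0.
have := ler_wpM2r (ltW u0) lm; rewrite -Qu; lra.
Qed.

Lemma grid_cover m Q x : 0 < Q.2 -> cube_set Q x ->
  exists i, cube_set (@grid_cube m Q i) x.
Proof.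
move=> Qp xQ; set u := Q.2 / m.+2%:R; have u0 : 0 < u by rewrite divr_gt0.
have Qu : Q.2 = m.+2%:R * u by rewrite mulrC divfK// pnatr_eq0.
have cell k (X : R) : 0 <= X -> X <= k.+2%:R * u ->
    exists j : 'I_k.+1, j%:R * u <= X <= j.+2%:R * u.
  move=> X0; elim: k => [|k IH] Xk.
    by exists ord0; rewrite mul0r X0.
  have [/IH[j Xj]|kX] := leP X (k.+2%:R * u).
    by exists (widen_ord (leqnSn _) j).
  exists ord_max; rewrite Xk andbT; apply: le_trans (ltW kX).
  by rewrite ler_pM2r// ler_nat.
have H l : exists j : 'I_m.+1,
    j%:R * u <= x ord0 l - Q.1 ord0 l + Q.2 / 2 <= j.+2%:R * u.
  by have := xQ l; rewrite ler_norml => /andP[? ?]; apply: cell; rewrite -?Qu; lra.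
exists [ffun l => xchoose (H l)] => l; rewrite !mxE ffunE /= -/u.
have /andP := xchooseP (H l); set j := xchoose (H l).
rewrite -[j.+2%:R]natr1 -[j.+1%:R]natr1 ler_norml => -[? ?].
by apply/andP; split; lra.
Qed.

(** Two blocks containing [x] have indices that differ by at most 2 in every
coordinate, so their residues modulo 3 tell them apart. *)
Lemma grid_overlap m Q x : 0 < Q.2 ->
  (count (fun q => x \in cube_set q) (grid m Q) <= 3 ^ n)%N.
Proof.
move=> Qp; set u := Q.2 / m.+2%:R; have u0 : 0 < u by rewrite divr_gt0.
rewrite count_map.
pose A := [set i | x \in cube_set (@grid_cube m Q i)]%SET.
have -> : count (preim (@grid_cube m Q) (fun q => x \in cube_set q))
    (enum {ffun 'I_n -> 'I_m.+1}) = #|A|.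
  rewrite -sum1_count -sum1_card big_enum_cond.
  by apply: eq_bigl => i; rewrite /A finset.in_set.
have bounds i l : i \in A ->
    (i l)%:R * u <= x ord0 l - Q.1 ord0 l + Q.2 / 2 <= (i l).+2%:R * u.
  rewrite finset.in_set inE => /(_ l); rewrite !mxE /= -/u ler_norml => /andP[].
  rewrite -[(i l).+2%:R]natr1 -[(i l).+1%:R]natr1 => ? ?.
  by apply/andP; split; lra.
pose g (i : {ffun 'I_n -> 'I_m.+1}) : {ffun 'I_n -> 'I_3} :=
  [ffun l => inord (i l %% 3)].
have gI : {in A &, injective g}.
  move=> i j iA jA /ffunP gij; apply/ffunP => l; apply/val_inj => /=.
  have := congr1 (@nat_of_ord 3) (gij l); rewrite !ffunE !inordK ?ltn_mod//.
  have /andP[i1 i2] := bounds i l iA; have /andP[j1 j2] := bounds j l jA.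
  have : (i l <= (j l).+2)%N by rewrite -(ler_nat R) -(ler_pM2r u0) (le_trans i1).
  have : (j l <= (i l).+2)%N by rewrite -(ler_nat R) -(ler_pM2r u0) (le_trans j1).
  by move: (nat_of_ord (i l)) (nat_of_ord (j l)); clear => a b; lia.
rewrite -(card_in_imset gI) (leq_trans (max_card _))//.
by rewrite card_ffun !card_ord.
Qed.

(** Each block is joined to the lowest one by decreasing all positive indices by
1 at a time.  Consecutive blocks share a cell [v], of volume [u ^+ n], so their
means differ by at most [D], and at most [m] steps are needed. *)
Lemma grid_osc m Q f : 0 < Q.2 -> L1 (cube_set Q) f ->
  osc Q f <= (2 * (1 + m.+1%:R ^+ n * 2 ^+ n * (2 * m%:R))) *
    \sum_(q <- grid m Q) osc q f.
Proof.
move=> Qp fi; set T := \sum_(q <- _) _.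
have [u [u0 uE]] : exists u, 0 < u /\ u = Q.2 / m.+2%:R.
  by exists (Q.2 / m.+2%:R); rewrite divr_gt0.
have un0 : 0 < u ^+ n by rewrite exprn_gt0.
pose I := {ffun 'I_n -> 'I_m.+1}.
pose c (i : I) := grid_cube Q i.
have c2 i : (c i).2 = 2 * u by rewrite /= uE.
have cp i : 0 < (c i).2 by exact: grid_cube_gt0.
have cQ i : cube_set (c i) `<=` cube_set Q.
  by apply: inside_subset; exact: grid_cube_inside.
have fic i : L1 (cube_set (c i)) f.
  by apply: L1_subset fi => //; exact: measurable_cube.
have TE : T = \sum_(i <- enum I) osc (c i) f by rewrite /T big_map.
have oscT i : osc (c i) f <= T.
  rewrite TE big_enum (bigD1 i)//= lerDl sumr_ge0// => j _; exact: osc_ge0.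
have T0 : 0 <= T := le_trans (osc_ge0 _ _) (oscT [ffun=> ord0]).
pose i0 : I := [ffun=> ord0].
pose pr (i : I) : I := [ffun l => inord (i l).-1].
have prE i l : (pr i l : nat) = (i l).-1.
  by rewrite ffunE inordK// (leq_ltn_trans (leq_pred _)).
pose D := 2 * (u ^+ n)^-1 * T.
have D0 : 0 <= D by rewrite !mulr_ge0// invr_ge0 ltW.
have step i : `|avg (c i) f - avg (c (pr i)) f| <= D.
  pose v : 'rV[R]_n * R := (Q.1 + \row_l (- (Q.2 / 2) + ((i l)%:R + 1 / 2) * u), u).
  have vc : cube_set v `<=` cube_set (c i).
    apply: inside_subset; apply/insideP => l; rewrite !mxE /= -uE -[(i l).+1%:R]natr1.
    rewrite [X in `|X|](_ : _ = - (u / 2)); last by field.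
    by rewrite normrN gtr0_norm ?divr_gt0//; lra.
  have vp : cube_set v `<=` cube_set (c (pr i)).
    apply: inside_subset; apply/insideP => l; rewrite !mxE /= -uE prE.
    have [->|] := posnP (i l); rewrite /=.
      rewrite [X in `|X|](_ : _ = - (u / 2)); last by field.
      by rewrite normrN gtr0_norm ?divr_gt0//; lra.
    move=> il; rewrite prednK// [X in `|X|](_ : _ = u / 2); last by field.
    by rewrite gtr0_norm ?divr_gt0//; lra.
  have H1 := avg_dist (avg (c i) f) (u0 : 0 < v.2) (ltW (cp i)) vc (fic i).
  have H2 := avg_dist (avg (c (pr i)) f) (u0 : 0 < v.2) (ltW (cp (pr i))) vp (fic _).
  have := ler_distD (avg v f) (avg (c i) f) (avg (c (pr i)) f).
  rewrite (distrC (avg (c i) f) (avg v f)) => /le_trans; apply.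
  apply: le_trans (lerD H1 H2) _; rewrite /D -mulrA mulr2n mulrDl mul1r.
  by apply: lerD; rewrite ler_wpM2l ?invr_ge0 ?(ltW un0)// oscT.
have chain k (i : I) : (forall l, (i l <= k)%N) ->
    `|avg (c i) f - avg (c i0) f| <= k%:R * D.
  elim: k i => [|k IH] i ik.
    suff -> : i = i0 by rewrite subrr normr0 mul0r.
    apply/ffunP => l; apply/val_inj; rewrite ffunE /=.
    by have := ik l; rewrite leqn0 => /eqP.
  have prk l : (pr i l <= k)%N by rewrite prE; have := ik l; lia.
  have := ler_distD (avg (c (pr i)) f) (avg (c i) f) (avg (c i0) f).
  move=> /le_trans; apply; rewrite -natr1 mulrDl mul1r addrC.
  by apply: lerD; [exact: IH|exact: step].
have IQ : L1dist (cube_set Q) f (avg (c i0) f) <=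
    \sum_(i <- enum I) L1dist (cube_set (c i)) f (avg (c i0) f).
  apply: (@L1dist_cover R n _ (enum I) (fun i => cube_set (c i)) Q
    (cube_set Q) f _ (ltW Qp) (measurable_cube Q)
    (fun i _ => measurable_cube (c i)) _ _ _ fi) => //.
  by move=> x /(@grid_cover m _ _ Qp)[i xi]; exists i; rewrite ?mem_enum.
apply: le_trans (osc_le_L1dist (avg (c i0) f) Qp fi) _.
rewrite -mulrA ler_pM2l//; apply: le_trans IQ _.
have Ii i : L1dist (cube_set (c i)) f (avg (c i0) f) <=
    osc (c i) f + (2 * u) ^+ n * (m%:R * D).
  apply: le_trans (L1dist_shift (avg (c i0) f) (avg (c i) f)
    (measurable_cube (c i)) (ltW (cp i)) (@subset_refl _ _) (fic i)) _.
  apply: lerD; first exact: lexx.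
  rewrite c2; apply: ler_wpM2l; first by rewrite exprn_ge0// mulr_ge0// ltW.
  apply: chain => l; rewrite -ltnS; exact: ltn_ord.
apply: le_trans (ler_sum _ (fun i _ => Ii i)) _.
rewrite big_split /= -TE [leRHS]mulrDl mul1r lerD2l.
rewrite big_const_seq count_predT -cardE card_ffun !card_ord iter_addr_0.
rewrite -[_ *+ _]mulr_natl natrX /D exprMn le_eqVlt; apply/orP; left; apply/eqP.
by field; rewrite gt_eqF.
Qed.

End grid.

(** * The estimate on a single cube *)

(** Up to the constant, this is Jensen's inequality.  Summing the pointwise bound
b <= 1 + b^p for b = a_i / t, where t = S / (2 * W), the term 1
accounts for at most half of the sum, so the powers account for the rest. *)
Lemma weighted_power_mean (R : realType) (I : Type) (s : seq I) (w a : I -> R)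
    (W p : R) : 1 < p -> 0 < W -> (forall i, 0 <= w i) -> (forall i, 0 <= a i) ->
  \sum_(i <- s) w i <= W ->
  W * ((\sum_(i <- s) w i * a i) / (2 * W)) `^ p <= \sum_(i <- s) w i * a i `^ p.
Proof.
move=> p1 W0 w0 a0 sW; set S := \sum_(i <- s) w i * a i.
have S0 : 0 <= S by rewrite sumr_ge0// => i _; rewrite mulr_ge0.
have [t tE] : exists t, t = S / (2 * W) by exists (S / (2 * W)).
rewrite -tE; have : 0 <= t by rewrite tE divr_ge0// mulr_ge0// ltW.
rewrite le_eqVlt => /predU1P[<-|t0].
  rewrite powR0 ?gt_eqF ?(lt_trans ltr01)// mulr0 sumr_ge0// => i _.
  by rewrite mulr_ge0// powR_ge0.
have SE : S = 2 * (t * W) by rewrite tE; field; rewrite gt_eqF.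
have b1 (b : R) : 0 <= b -> b <= 1 + b `^ p.
  move=> b0; have [b1|b1] := leP b 1.
    by rewrite (le_trans b1)// lerDl powR_ge0.
  rewrite (@le_trans _ _ (b `^ p))//; last by rewrite lerDr.
  by rewrite -{1}(powRr1 b0) ler_powR// ltW.
have ai i : a i `^ p = t `^ p * (a i / t) `^ p.
  have t1 := ltW t0.
  by rewrite -powRM ?divr_ge0// mulrC divfK// gt_eqF.
have : S <= t * W + t * \sum_(i <- s) w i * (a i / t) `^ p.
  apply: (@le_trans _ _ (\sum_(i <- s) (t * w i + t * (w i * (a i / t) `^ p)))).
    apply: ler_sum => i _; have := b1 (a i / t) (divr_ge0 (a0 i) (ltW t0)).
    rewrite ler_pdivrMr// => /(ler_wpM2l (w0 i)) => /le_trans; apply.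
    by rewrite le_eqVlt; apply/orP; left; apply/eqP; ring.
  by rewrite big_split /= -!mulr_sumr lerD2r ler_pM2l.
rewrite SE -lerBlDl mulr2n mulrDl mul1r addrK ler_pM2l// => H.
under eq_bigr do rewrite ai mulrCA.
by rewrite -mulr_sumr mulrC ler_wpM2l// powR_ge0.
Qed.

(** [2 ^ n * 5] for the tree and [3 ^ n] for the grid inside each of its
cubes. *)
Definition overlap_const (n : nat) : nat := (2 ^ n * 5 * 3 ^ n)%N.

Section local_estimate.
Context {R : realType} {n : nat}.
Implicit Types (Q q : 'rV[R]_n * R) (f : 'rV[R]_n -> R) (F : seq ('rV[R]_n * R)).

Definition energy (p : R) f Q : R :=
  vol Q * avg Q (fun x => `|f x - avg Q f|) `^ p.

Definition overlap_le (M : nat) F : Prop :=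
  forall x, (count (fun q => x \in cube_set q) F <= M)%N.

Lemma energy_ge0 p f Q : 0 < Q.2 -> 0 <= energy p f Q.
Proof. by move=> Qp; rewrite mulr_ge0 ?powR_ge0// volE ?exprn_ge0 ?ltW. Qed.

(** The families of the tree are dilatable by 4/3 only, and the grid trades this
for [lambda] without making the overlap depend on [lambda]. *)
Lemma osc_le_local_family (lambda : R) : exists2 C : R, 0 < C &
  forall Q f, 0 < Q.2 -> L1 (cube_set Q) f -> exists F,
    [/\ forall q, q \in F -> 0 < q.2 /\ inside (dilate lambda q) Q,
        overlap_le (overlap_const n) F &
        osc Q f <= C * \sum_(q <- F) osc q f].
Proof.
(* With this m the grid cubes of a cube S remain in (4/3) S when dilated. *)
have [m Hm] : exists m : nat, 6 * lambda <= m.+2%:R.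
  have [k Hk] : exists k : nat, 6 * lambda <= k%:R.
    exists (Num.bound `|6 * lambda|).
    exact: le_trans (ler_norm _) (ltW (archi_boundP (normr_ge0 _))).
  by exists k; apply: le_trans Hk _; rewrite ler_nat -addn2 leq_addr.
pose C2 : R := 2 * (1 + m.+1%:R ^+ n * 2 ^+ n * (2 * m%:R)).
have C20 : 0 < C2.
  by rewrite mulr_gt0// ltr_wpDr// !mulr_ge0// exprn_ge0.
pose C1 : R := 2 * 4 ^+ n.
have C10 : 0 < C1 by rewrite mulr_gt0// exprn_gt0.
(* One factor 2 comes from replacing the mean over Q by c, the other one from
   passing from Q to the shrunken cube. *)
exists (4 * C1 * C2); first by rewrite !mulr_gt0.
move=> Q f Qp fi.
pose c := avg (dilate (1 / 2) Q) f.
have [eta eta0 Heta] := L1dist_shrink c Qp fi.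
have [k Hk] : exists k : nat, 7 / 6 * Q.2 <= 2 ^+ k * eta.
  exists (Num.bound (7 / 6 * Q.2 / eta)); rewrite -ler_pdivrMr//.
  apply/ltW/(lt_le_trans (archi_boundP _)).
    by rewrite divr_ge0 ?mulr_ge0// ltW.
  by rewrite -natrX ler_nat ltnW// ltn_expl.
exists (flatten [seq grid m q | q <- whitney_tree Q k Q]); split.
- move=> q /flatten_mapP[S SQ /mem_grid[i ->]].
  have [Sp _] := whitney_tree_inside Qp SQ.
  split; first exact: grid_cube_gt0.
  apply: inside_trans (grid_cube_local i Sp Hm) _.
  exact: whitney_tree_local Qp (inside_refl Q) SQ.
- move=> x; have := @whitney_tree_overlap R n Q k Q x Qp (inside_refl Q).
  rewrite -(leq_pmul2r (_ : 0 < 3 ^ n)%N) ?expn_gt0// => /(leq_trans _); apply.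
  have : forall q, q \in whitney_tree Q k Q -> 0 < q.2.
    by move=> q /(whitney_tree_inside Qp)[].
  elim: (whitney_tree Q k Q) => [|S s IH] sp; first by rewrite leq0n.
  rewrite /= count_cat mulnDl leq_add//; last first.
    by apply: IH => q qs; apply: sp; rewrite in_cons qs orbT.
  have Sp : 0 < S.2 by apply: sp; rewrite mem_head.
  have [xS|xS] := boolP (x \in cube_set S); first by rewrite mul1n; exact: grid_overlap.
  rewrite mul0n leqn0 -leqn0 leqNgt -has_count; apply: contra xS.
  move=> /hasP[q /mem_grid[i ->]]; rewrite !inE.
  by apply: inside_subset; exact: grid_cube_inside.
- have := whitney_tree_L1dist Qp Qp (inside_refl Q) Hk fi.
  have -> : cube_set Q `&` cube_set (Q.1, Q.2 - 2 * eta) =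
      cube_set (Q.1, Q.2 - 2 * eta).
    apply/setIidr/cube_subset => i /=; rewrite subrr normr0 add0r; lra.
  rewrite -/c -/C1 => H.
  have Ho := osc_le_L1dist c Qp fi.
  have HT : \sum_(q <- whitney_tree Q k Q) osc q f <=
      C2 * \sum_(q <- flatten [seq grid m q | q <- whitney_tree Q k Q]) osc q f.
    rewrite big_flatten big_map mulr_sumr big_seq [leRHS]big_seq.
    apply: ler_sum => q qt; have [qp qQ] := whitney_tree_inside Qp qt.
    apply: grid_osc => //; apply: L1_subset fi.
    + exact: measurable_cube.
    + exact: measurable_cube.
    + exact: inside_subset.
  have {}HT := ler_wpM2l (ltW C10) HT.
  rewrite -mulrA -mulrA; lra.
Qed.

(** Here bounded overlap is used a second time: it bounds the total volume of the
family, which is what the power mean inequality requires. *)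
Lemma energy_le_local_family (lambda p : R) : 1 < lambda -> 1 < p -> exists2 C : R, 0 < C &
  forall Q f, 0 < Q.2 -> L1 (cube_set Q) f -> exists F,
    [/\ forall q, q \in F -> 0 < q.2 /\ inside (dilate lambda q) Q,
        overlap_le (overlap_const n) F &
        energy p f Q <= C * \sum_(q <- F) energy p f q].
Proof.
move=> l1 p1; have [C0 C00 HC] := osc_le_local_family lambda.
pose M : R := (overlap_const n)%:R.
have M1 : 1 <= M by rewrite ler1n !muln_gt0 !expn_gt0.
have M0 := lt_le_trans ltr01 M1.
exists ((2 * M * C0) `^ p); first by rewrite powR_gt0// !mulr_gt0.
move=> Q f Qp fi; have [F [FQ FM HF]] := HC Q f Qp fi.
exists F; split=> //.
have vQ : 0 < vol Q by rewrite volE ?exprn_gt0 ?ltW.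
have v0 q : 0 <= vol q by rewrite fine_ge0.
pose a q := (vol q)^-1 * osc q f.
have a0 q : 0 <= a q by rewrite mulr_ge0 ?osc_ge0// invr_ge0.
have qQ q : q \in F -> cube_set q `<=` cube_set Q.
  move=> /FQ[qp qQ]; apply: inside_subset; apply: inside_trans qQ.
  by rewrite -[X in inside X _]dilate1; apply: inside_dilate; exact: ltW.
have sW : \sum_(q <- F) vol q <= M * vol Q.
  pose B q := cube_set q `&` cube_set Q.
  have mB q : lebesgue_measurable (B q).
    by apply: measurableI; exact: measurable_cube.
  have := @sum_measure_overlap _ _ R (lebesgue_rV R n) _ F B (cube_set Q)
    (overlap_const n) mB (fun q => @subIsetr _ _ _) (measurable_cube Q)
    (cube_lt_pinfty (ltW Qp)).
  have cM : forall x, (count (fun q => x \in B q) F <= overlap_const n)%N.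
    move=> x; apply: leq_trans (FM x); apply: sub_count => q.
    by rewrite !inE => -[].
  move=> /(_ cM); apply: le_trans.
  rewrite big_seq [leRHS]big_seq; apply: ler_sum => q /qQ /setIidl qE.
  by rewrite /B qE.
have W0 : 0 < M * vol Q by rewrite mulr_gt0.
have := weighted_power_mean p1 W0 v0 a0 sW.
have -> : \sum_(q <- F) vol q * a q = \sum_(q <- F) osc q f.
  rewrite big_seq [RHS]big_seq; apply: eq_bigr => q /FQ[qp _].
  by rewrite /a mulrA divff ?mul1r// volE ?ltW// expf_neq0// gt_eqF.
set S := \sum_(q <- F) osc q f.
have S0 : 0 <= S by rewrite sumr_ge0// => q _; exact: osc_ge0.
move=> H; rewrite mulr_sumr.
under eq_bigr do rewrite /energy avg_oscE -/(a _).
rewrite -mulr_sumr; apply: le_trans (ler_wpM2l (powR_ge0 _ _) H).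
rewrite /energy avg_oscE.
pose t := S / (2 * (M * vol Q)).
have t0 : 0 <= t by rewrite divr_ge0// mulr_ge0// ltW.
have at_ : (vol Q)^-1 * osc Q f <= 2 * M * C0 * t.
  have {}HF := ler_wpM2l (ltW (_ : 0 < (vol Q)^-1)) HF.
  apply: le_trans (HF _) _; first by rewrite invr_gt0.
  have E (v m c s : R) : 0 < v -> 0 < m ->
      v^-1 * (c * s) = 2 * m * c * (s / (2 * (m * v))).
    by move=> v1 m1; field; rewrite !gt_eqF.
  by rewrite (E _ M).
have /(ge0_ler_powR (ltW (lt_trans ltr01 p1))) := at_.
rewrite !nnegrE => /(_ (a0 Q)) H2.
have {}H2 := H2 (mulr_ge0 (ltW (mulr_gt0 (mulr_gt0 (ltr0Sn _ _) M0) C00)) t0).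
apply: le_trans (ler_wpM2l (ltW vQ) H2) _.
rewrite powRM//; last by rewrite !mulr_ge0 ?ltW.
rewrite mulrCA ler_wpM2l ?powR_ge0// ler_wpM2r ?powR_ge0//.
by rewrite ler_pMl.
Qed.

End local_estimate.

(** * Maximal dyadic cubes of an open set *)

Section dyadic.
Context {R : realType} {n : nat}.
Implicit Types (Q q : 'rV[R]_n * R) (x y z : 'rV[R]_n) (G : set 'rV[R]_n).

Lemma nbhs_rVP x G : nbhs x G <->
  exists2 e : R, 0 < e & forall y, (forall l, `|x ord0 l - y ord0 l| < e) -> G y.
Proof.
split=> [/nbhs_ballP[e /= e0 eG]|[e e0 eG]].
  exists e => // y xy; apply: eG; split=> // i l.
  by rewrite ord1; exact: xy.
apply/nbhs_ballP; exists e => //= y [_ xy]; apply: eG => l.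
exact: xy.
Qed.

Lemma open_cube_interior Q : open_cube Q `<=` interior (cube_set Q).
Proof.
move=> x xQ; apply/nbhs_rVP.
have [e e0 He] : exists2 e : R, 0 < e &
    forall l, `|x ord0 l - Q.1 ord0 l| + e <= Q.2 / 2.
  have xl l : 0 < Q.2 / 2 - `|x ord0 l - Q.1 ord0 l| by rewrite subr_gt0; exact: xQ.
  exists (\big[Num.min/1]_l (Q.2 / 2 - `|x ord0 l - Q.1 ord0 l|)).
    by rewrite lt_bigmin.
  by move=> l; rewrite addrC -lerBrDr; exact: bigmin_le.
exists e => // y xy l; have := He l; have := xy l.
have := ler_distD (x ord0 l) (y ord0 l) (Q.1 ord0 l); rewrite (distrC (y _ _) (x _ _)); lra.
Qed.

(** The index of the half-open dyadic cube of generation [j] that contains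
[y]. *)
Definition dyadic_index (j : nat) y : {ffun 'I_n -> int} :=
  [ffun l => Num.floor (2 ^+ j * y ord0 l)].

Definition dyadic_cube (j : nat) (a : {ffun 'I_n -> int}) : 'rV[R]_n * R :=
  (\row_l (((a l)%:~R + 1 / 2) / 2 ^+ j), (2 ^+ j)^-1).

Lemma dyadic_cube_mem j x : cube_set (dyadic_cube j (dyadic_index j x)) x.
Proof.
move=> l; rewrite !mxE ffunE /=; have /andP[] := floor_itv (2 ^+ j * x ord0 l).
have t0 : (0 : R) < 2 ^+ j by rewrite exprn_gt0.
rewrite intrD; set a : R := _%:~R => H1 H2.
have -> : x ord0 l = (2 ^+ j * x ord0 l) / 2 ^+ j.
  by rewrite mulrAC divff ?mul1r// gt_eqF.
rewrite -mulrBl normrM [X in _ * X]gtr0_norm ?invr_gt0// mulrC.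
rewrite ler_pM2l ?invr_gt0// ler_norml; apply/andP; split; lra.
Qed.

Lemma dyadic_cube_index j a y :
  open_cube (dyadic_cube j a) y -> dyadic_index j y = a.
Proof.
move=> ya; apply/ffunP => l; have := ya l; rewrite !mxE ffunE /=.
have t0 : (0 : R) < 2 ^+ j by rewrite exprn_gt0.
have -> : y ord0 l = (2 ^+ j * y ord0 l) / 2 ^+ j.
  by rewrite mulrAC divff ?mul1r// gt_eqF.
rewrite -mulrBl normrM [X in _ * X]gtr0_norm ?invr_gt0// mulrC.
rewrite ltr_pM2l ?invr_gt0// ltr_norml => /andP[H1 H2].
rewrite mulrCA divff ?mulr1; last by rewrite gt_eqF.
by apply: floor_def; rewrite intrD; apply/andP; split; lra.
Qed.

(** Dyadic cubes are nested: the floor of [u] is determined by that of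
[2 * u]. *)
Lemma dyadic_index_coarser i j y z : (i <= j)%N ->
  dyadic_index j y = dyadic_index j z -> dyadic_index i y = dyadic_index i z.
Proof.
have half (u v : R) : Num.floor (2 * u) = Num.floor (2 * v) ->
    Num.floor u = Num.floor v.
  move=> uv; apply/floor_def.
  have /andP[v1 v2] := floor_itv v; have /andP[u1 u2] := floor_itv (2 * u).
  have : (2 * Num.floor v <= Num.floor (2 * u))%R.
    by rewrite uv floor_ge_int intrM ler_pM2l.
  have : (Num.floor (2 * u) < 2 * (Num.floor v + 1))%R.
    by rewrite uv floor_lt_int intrM ltr_pM2l.
  rewrite -lezD1 -!(ler_int R) !(intrD, intrM).
  rewrite intrD in u2.
  by move=> H1 H2; apply/andP; split; lra.
move=> ij /ffunP yz; apply/ffunP => l; have := yz l; rewrite !ffunE.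
elim: j ij {yz} => [|j IH]; first by rewrite leqn0 => /eqP ->.
rewrite leq_eqVlt => /predU1P[->//|]; rewrite ltnS => /IH {}IH.
by rewrite exprS -!mulrA => /half/IH.
Qed.

(** Only generations [j >= 0] occur, so around a point that has a good cube
there is a largest one, even when all cubes are good. *)
Definition maximal_dyadic (good : set ('rV[R]_n * R)) : set ('rV[R]_n * R) :=
  [set Q | exists j y, [/\ Q = dyadic_cube j (dyadic_index j y), good Q &
     forall i, (i < j)%N -> ~ good (dyadic_cube i (dyadic_index i y))]].

Lemma maximal_dyadic_gt0 good Q : maximal_dyadic good Q -> 0 < Q.2.
Proof. by move=> [j [y [-> _ _]]]; rewrite /= invr_gt0 exprn_gt0. Qed.

Lemma maximal_dyadic_cover good x :
  (exists j, good (dyadic_cube j (dyadic_index j x))) ->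
  exists2 Q, maximal_dyadic good Q & cube_set Q x.
Proof.
move=> ex; pose P j := `[< good (dyadic_cube j (dyadic_index j x)) >].
have exP : exists j, P j by have [j gj] := ex; exists j; apply/asboolP.
case: (ex_minnP exP) => j /asboolP gj jmin.
exists (dyadic_cube j (dyadic_index j x)); last exact: dyadic_cube_mem.
exists j, x; split=> // i ij gi.
have /jmin : P i by apply/asboolP.
by rewrite leqNgt ij.
Qed.

(** If the two cubes had different generations, the larger one would be a good
cube around the point that defines the smaller one. *)
Lemma maximal_dyadic_disjoint good Q Q' z :
  maximal_dyadic good Q -> maximal_dyadic good Q' ->
  open_cube Q z -> open_cube Q' z -> Q = Q'.
Proof.
have main j j' y y' : (j <= j')%N ->
    dyadic_index j z = dyadic_index j y ->
    dyadic_index j' z = dyadic_index j' y' ->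
    good (dyadic_cube j (dyadic_index j y)) ->
    (forall i, (i < j')%N -> ~ good (dyadic_cube i (dyadic_index i y'))) ->
    j = j'.
  move=> jj zy zy' gj nj; apply/eqP; rewrite eqn_leq jj leqNgt.
  apply/negP => /nj; apply.
  by rewrite -(dyadic_index_coarser jj zy') zy.
move=> [j [y [-> gj nj]]] [j' [y' [-> gj' nj']]] /dyadic_cube_index zj.
move=> /dyadic_cube_index zj'.
suff jE : j = j' by subst j'; rewrite -zj -zj'.
have [jj|/ltnW jj] := leqP j j'; first exact: main jj zj zj' gj nj'.
by apply/esym; exact: main jj zj' zj gj' nj.
Qed.

Lemma dyadic_local G (lambda : R) x : 1 < lambda -> open G -> G x ->
  exists j, cube_set (dilate lambda (dyadic_cube j (dyadic_index j x))) `<=` G.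
Proof.
move=> l1 oG Gx; have /nbhs_rVP[e e0 He] : nbhs x G by exact: open_nbhs_nbhs.
have l0 : 0 < 1 + lambda by lra.
exists (Num.bound ((1 + lambda) / e)); set j := Num.bound _ => y yQ.
have je : (1 + lambda) * (2 ^+ j)^-1 < e.
  rewrite ltr_pdivrMr ?exprn_gt0// -ltr_pdivrMl// mulrC.
  apply: lt_trans (archi_boundP _) _; first by rewrite divr_ge0 ?ltW.
  by rewrite -natrX ltr_nat ltn_expl.
apply: He => l; have := yQ l; have := dyadic_cube_mem j x l; rewrite /=.
move: je; set t := (2 ^+ j)^-1; set c := (\row__ _) ord0 l => je xc yc.
by have := ler_distD c (x ord0 l) (y ord0 l); rewrite (distrC c); lra.
Qed.

(** An open set is the union of the dyadic cubes that it contains, and there are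
countably many of them. *)
Lemma open_lebesgue_measurable G : open G -> lebesgue_measurable G.
Proof.
move=> oG; pose F (ja : nat * {ffun 'I_n -> int}) : set 'rV[R]_n :=
  [set x | cube_set (dyadic_cube ja.1 ja.2) x /\
           cube_set (dyadic_cube ja.1 ja.2) `<=` G].
have -> : G = \bigcup_ja F ja.
  apply/seteqP; split=> [x Gx|x [ja _ [xj]]]; last exact.
  have [|j jG] := @dyadic_local G 2 x _ oG Gx; first by rewrite ltr1n.
  exists (j, dyadic_index j x) => //; split; first exact: dyadic_cube_mem.
  apply: subset_trans jG; rewrite -[X in cube_set X `<=` _]dilate1.
  apply/inside_subset/inside_dilate; last by rewrite ler1n.
  by rewrite /= invr_ge0 exprn_ge0.
apply: (@countable_bigcupT_measurable _
  (caratheodory_type (mu_ext (product_lebesgue R n)))) => [|ja].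
  exact: countableP.
have [jG|jG] := pselect (cube_set (dyadic_cube ja.1 ja.2) `<=` G).
  rewrite (_ : F ja = cube_set (dyadic_cube ja.1 ja.2)).
    exact: measurable_cube.
  by apply/seteqP; split=> [x []|x xj].
by rewrite (_ : F ja = set0) -?subset0// => x [].
Qed.

End dyadic.

(** * From one cube to a partition *)

Section assembly.
Context {R : realType} {n : nat}.
Implicit Types (Q q : 'rV[R]_n * R) (F s : seq ('rV[R]_n * R)).

Lemma count_le1 (T : eqType) (a : pred T) (s : seq T) : uniq s ->
  {in s &, forall x y, a x -> a y -> x = y} -> (count a s <= 1)%N.
Proof.
elim: s => //= x s IH /andP[xs us] sa.
have IH' : (count a s <= 1)%N.
  by apply: IH => // y z ys zs; apply: sa; rewrite in_cons ?ys ?zs orbT.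
have [ax|//] := boolP (a x); rewrite (_ : count a s = 0%N)//.
apply/eqP; rewrite -leqn0 leqNgt -has_count; apply: contra xs => /hasP[y ys ay].
by rewrite (sa x y)// ?mem_head// in_cons ys orbT.
Qed.

Lemma count_uniq_subset (T : eqType) (a : pred T) (s1 s2 : seq T) :
  uniq s1 -> {subset s1 <= s2} -> (count a s1 <= count a s2)%N.
Proof.
move=> u1 s12; rewrite -!size_filter; apply: uniq_leq_size.
  by rewrite filter_uniq.
by move=> x; rewrite !mem_filter => /andP[-> /s12].
Qed.

(** Families are lists and partitions are sets; dropping repetitions costs the
multiplicity. *)
Lemma sum_undup_le (T : eqType) (s : seq T) (M : nat) (g : T -> R) :
  (forall x, x \in s -> 0 <= g x) -> (forall x, x \in s -> (count_mem x s <= M)%N) ->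
  \sum_(x <- s) g x <= M%:R * \sum_(x <- undup s) g x.
Proof.
move=> g0 sM; rewrite -big_undup_iterop_count mulr_sumr big_seq [leRHS]big_seq.
apply: ler_sum => x; rewrite mem_undup => xs.
rewrite (_ : iterop _ _ _ _ = g x *+ count_mem x s)// -[X in X <= _]mulr_natl.
by rewrite ler_wpM2r ?g0// ler_nat sM.
Qed.

Lemma esum_indic_le (P : set ('rV[R]_n * R)) (N : nat) x :
  (forall s, uniq s -> (forall q, q \in s -> P q) ->
     (count (fun q => x \in cube_set q) s <= N)%N) ->
  (\esum_(Q in P) (\1_(cube_set Q) x : R)%:E <= (N%:R : R)%:E)%E.
Proof.
move=> H; apply/ereal_supP => _ [A [finA AP] <-].
rewrite fsbig_finite// sumEFin lee_fin.
under eq_bigr do rewrite indicE.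
rewrite -natr_sum ler_nat.
have AN := H (finmap.enum_fset (fset_set A)) (finmap.fset_uniq _).
apply: leq_trans (AN _); last by move=> q; rewrite in_fset_set// inE => /AP.
by rewrite -sum1_count [leqRHS]big_mkcond; apply: leq_sum => i _; case: ifP.
Qed.

(** The maximal dyadic cubes cover [G] and have disjoint interiors, so they add at
most [2 ^ n] to the overlap. *)
Lemma local_partition_extend (lambda : R) (M N : nat) (G : set 'rV[R]_n) F :
  1 < lambda -> open G -> (M + 2 ^ n <= N)%N ->
  (forall q, q \in F -> 0 < q.2 /\ cube_set (dilate lambda q) `<=` G) ->
  overlap_le M F ->
  exists2 P, local_partition lambda N G P & forall q, q \in F -> P q.
Proof.
move=> l1 oG MN FG FM.
pose W : set ('rV[R]_n * R) :=
  maximal_dyadic [set Q | cube_set (dilate lambda Q) `<=` G].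
exists ([set` F] `|` W); last by move=> q qF; left.
have PG Q : ([set` F] `|` W) Q -> 0 < Q.2 /\ cube_set (dilate lambda Q) `<=` G.
  move=> [/FG//|WQ]; split; first exact: maximal_dyadic_gt0 WQ.
  by case: WQ => j [y []].
split=> //.
- apply/seteqP; split=> [x Gx|x [Q /PG[Qp QG] xQ]].
    have [|Q WQ xQ] := @maximal_dyadic_cover R n
      [set Q | cube_set (dilate lambda Q) `<=` G] x.
      exact: dyadic_local.
    by exists Q => //; right.
  apply: QG; move: xQ; rewrite -[X in cube_set X x -> _]dilate1.
  by apply/inside_subset/inside_dilate; exact: ltW.
- move=> x Gx; apply: esum_indic_le => s us sP; apply: leq_trans MN.
  rewrite -(seq.permP (permEl (perm_filterC (mem F) s))) count_cat leq_add//.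
    apply: leq_trans (FM x); apply: count_uniq_subset.
      by rewrite filter_uniq.
    by move=> q; rewrite mem_filter => /andP[].
  rewrite -[(2 ^ n)%N]muln1; apply: closed_overlap.
    by move=> q; rewrite mem_filter => /andP[_ /sP/PG[]].
  move=> y; apply: count_le1; first by rewrite filter_uniq.
  have WP q : q \in [seq q <- s | predC (mem F) q] -> W q.
    by rewrite mem_filter => /andP[/= qF /sP[/= qF'|//]]; rewrite qF' in qF.
  move=> q q' /WP Wq /WP Wq'; rewrite !inE => yq yq'.
  exact: maximal_dyadic_disjoint Wq Wq' yq yq'.
Qed.

(** A repeated cube is counted in the overlap at its own centre, so the
multiplicities are at most [M]. *)
Lemma energy_le_JN_loc (lambda p : R) (M N : nat) (G : set 'rV[R]_n) f F :
  1 < lambda -> open G -> (M + 2 ^ n <= N)%N ->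
  (forall q, q \in F -> 0 < q.2 /\ cube_set (dilate lambda q) `<=` G) ->
  overlap_le M F ->
  ((\sum_(q <- F) energy p f q)%:E <= M%:R%:E * JN_loc lambda N p f G)%E.
Proof.
move=> l1 oG MN FG FM.
have [P PG FP] := local_partition_extend l1 oG MN FG FM.
have H1 : \sum_(q <- F) energy p f q <= M%:R * \sum_(q <- undup F) energy p f q.
  apply: sum_undup_le => q qF; first by apply: energy_ge0; have [] := FG q qF.
  apply: leq_trans (FM q.1); apply: sub_count => q' /= /eqP ->.
  rewrite inE => i; rewrite subrr normr0 divr_ge0//; apply: ltW.
  by have [] := FG q qF.
apply: (@le_trans _ _ (M%:R * \sum_(q <- undup F) energy p f q)%:E).
  by rewrite lee_fin.
rewrite EFinM; apply: lee_wpmul2l; first by rewrite lee_fin.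
apply: (@le_trans _ _ (oscillation_sum p f P)); last first.
  by apply: ereal_sup_ubound; exists P.
apply: esum_ge; exists [set` undup F].
  split; first exact: finite_seq.
  by move=> q /=; rewrite mem_undup => /FP.
by rewrite -fsbig_seq ?undup_uniq// sumEFin.
Qed.

(** The families found inside the cubes of an admissible partition lie in the
interiors of these cubes, because [lambda > 1]; the interiors being disjoint,
the overlap of the union is that of a single family. *)
Lemma JN_le (lambda p : R) (N : nat) : 1 < lambda -> 1 < p ->
  (overlap_const n + 2 ^ n <= N)%N ->
  exists C : R, 0 < C /\ forall (G : set 'rV[R]_n) f, open G -> L1 G f ->
    (JN p f G <= C%:E * JN_loc lambda N p f G)%E.
Proof.
move=> l1 p1 MN; have [C C0 HC] := @energy_le_local_family R n lambda p l1 p1.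
have M0 : (0 : R) < (overlap_const n)%:R by rewrite ltr0n !muln_gt0 !expn_gt0.
exists (C * (overlap_const n)%:R); split; first by rewrite mulr_gt0.
move=> G f oG fi; apply/ereal_supP => _ [P [PG Pdisj PU] <-].
apply/ereal_supP => _ [A [finA AP] <-].
rewrite fsbig_finite// sumEFin -/(energy p f _).
set s := finmap.enum_fset (fset_set A).
have us : uniq s by exact: finmap.fset_uniq.
have sP Q : Q \in s -> P Q by rewrite in_fset_set// inE => /AP.
pose good Q F := [/\ forall q, q \in F -> 0 < q.2 /\ inside (dilate lambda q) Q,
   overlap_le (overlap_const n) F &
   energy p f Q <= C * \sum_(q <- F) energy p f q].
have [Fam HFam] : exists Fam, forall Q, Q \in s -> good Q (Fam Q).
  have : forall Q, exists F, Q \in s -> good Q F.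
    move=> Q; have [Qs|_] := boolP (Q \in s); last by exists [::].
    have [Qp QG] := PG Q (sP Q Qs).
    have fQ : L1 (cube_set Q) f.
      apply: L1_subset fi => //; first exact: measurable_cube.
      exact: open_lebesgue_measurable.
    by have [F HF] := HC Q f Qp fQ; exists F.
  by move=> /choice[Fam HF]; exists Fam.
pose FF := flatten [seq Fam Q | Q <- s].
have FFG q : q \in FF -> 0 < q.2 /\ cube_set (dilate lambda q) `<=` G.
  move=> /flatten_mapP[Q Qs qF]; have [/(_ q qF)[qp qQ] _ _] := HFam Q Qs.
  split=> //; apply: subset_trans (inside_subset qQ) _.
  by have [] := PG Q (sP Q Qs).
have FFM : overlap_le (overlap_const n) FF.
  move=> x.
  have x1 : (count (fun Q => x \in open_cube Q) s <= 1)%N.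
    apply: count_le1 => // Q Q' /sP PQ /sP PQ'; rewrite !inE => xQ xQ'.
    apply/eqP/negPn/negP => /eqP QQ'.
    have : set0 x by rewrite -(Pdisj Q Q' PQ PQ' QQ'); split; exact: open_cube_interior.
    by [].
  apply: (@leq_trans (count (fun Q => x \in open_cube Q) s * overlap_const n)%N);
    last by rewrite -[leqRHS]mul1n leq_mul2r x1 orbT.
  rewrite /FF; have : {subset s <= s} by [].
  elim: {-2}s => [|Q r IH] rs //=.
  rewrite count_cat mulnDl leq_add//; last first.
    by apply: IH => q qr; apply: rs; rewrite in_cons qr orbT.
  have [FQ FMQ _] := HFam Q (rs Q (mem_head _ _)).
  have [_|xQ] := boolP (x \in open_cube Q); first by rewrite mul1n FMQ.
  rewrite mul0n leqNgt -has_count; apply: contra xQ => /hasP[q qF].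
  have [qp /insideP qQ] := FQ q qF; rewrite !inE => xq i.
  have := qQ i; have := xq i; rewrite /=.
  have := ler_distD (q.1 ord0 i) (x ord0 i) (Q.1 ord0 i).
  have : q.2 < lambda * q.2 by rewrite ltr_pMl.
  lra.
apply: (@le_trans _ _ (C * \sum_(q <- FF) energy p f q)%:E).
  rewrite lee_fin /FF big_flatten big_map mulr_sumr big_seq [leRHS]big_seq.
  by apply: ler_sum => Q /HFam[].
rewrite !EFinM -muleA; apply: lee_wpmul2l; first by rewrite lee_fin ltW.
exact: energy_le_JN_loc.
Qed.

End assembly.

Theorem theorem3p1 (R : realType) (n : nat) (hn : (2 <= n)%N) :
  exists N0 : nat, forall N : nat, (N0 <= N)%N ->
  forall p lambda : R, 1 < p -> 1 < lambda ->
  exists C : R, 0 < C /\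
    forall (G : set 'rV[R]_n) (f : 'rV[R]_n -> R),
      open G -> G <> setT -> L1 G f ->
      (JN p f G <= C%:E * JN_loc lambda N p f G)%E.
Proof.
exists (overlap_const n + 2 ^ n)%N => N hN p lambda p1 l1.
have [C [C0 HC]] := JN_le l1 p1 hN.
by exists C; split=> // G f oG _ fi; exact: HC.
Qed.
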